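(* Let $W$ be a (possibly infinite) Coxeter group with finite generating set $S$ of simple reflections, let $\gamma\in W$ be a Coxeter element, and let $C_\gamma$ be the Cambrian semilattice, i.e. the set of $\gamma$-sortable elements of $W$ ordered by the (right) weak order. Then every closed interval in $C_\gamma$ is EL-shellable.
   Context: **Coxeter groups and weak order.** $(W,S)$ is a Coxeter system with finite set of generators $S=\{s_1,\dots,s_n\}$, $\ell_S$ is the word length. The (right) weak order is $u\leq_S v$ iff $\ell_S(v)=\ell_S(u)+\ell_S(u^{-1}v)$. It is a meet-semilattice in which every closed interval is finite. **Sortable elements.** A Coxeter element is a product of all generators, each used exactly once, in some order; number the generators so that $\gamma=s_1s_2\cdots s_n$. Let $\gamma^\infty=s_1\cdots s_n\,|\,s_1\cdots s_n\,|\cdots$ be the half-infinite word obtained by repeating $s_1\cdots s_n$ (dividers $|$ have no effect). The $\gamma$-sorting word of $w\in W$ is the reduced word for $w$ which is lexicographically first as a subword of $\gamma^\infty$. Write it as $w=s_1^{\delta_{1,1}}\cdots s_n^{\delta_{1,n}}|\cdots|s_1^{\delta_{l,1}}\cdots s_n^{\delta_{l,n}}$ with $\delta_{i,j}\in\{0,1\}$; the $i$-th block is $b_i=\{s_j\mid\delta_{i,j}=1\}$. The element $w$ is $\gamma$-sortable iff $b_1\supseteq b_2\supseteq\cdots\supseteq b_l$. (This does not depend on the chosen reduced word for $\gamma$.) **Cambrian semilattice.** $C_\gamma$ is the set of all $\gamma$-sortable elements of $W$ with the order $\leq_\gamma$ induced from $\leq_S$. It is a known fact that $C_\gamma$ is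 a sub-semilattice of the weak order, closed under meets of nonempty sets and under joins of sets having an upper bound. **EL-shellability.** For a finite bounded poset $P$ with set of covering relations $\mathcal{E}(P)$ and a poset $\Lambda$, an edge-labeling is a map $\lambda:\mathcal{E}(P)\to\Lambda$. For a saturated chain $c:p_0\lessdot p_1\lessdot\cdots\lessdot p_s$ let $\lambda(c)=(\lambda(p_0,p_1),\dots,\lambda(p_{s-1},p_s))$; $c$ is rising if $\lambda(c)$ is strictly increasing. Words over $\Lambda$ are compared lexicographically: $(p_1,\dots,p_s)\leq_{\Lambda^*}(q_1,\dots,q_t)$ iff either $s\leq t$ and $p_i=q_i$ for $1\le i\le s$, or $p_i<_\Lambda q_i$ for the least $i$ with $p_i\neq q_i$. A maximal chain $c$ is lexicographically first if $\lambda(c)\leq_{\Lambda^*}\lambda(c')$ for every other maximal chain $c'$. The map $\lambda$ is an EL-labeling of $P$ if in every closed interval $[x,y]$ of $P$ there is a unique rising maximal chain, and it is lexicographically first among all maximal chains of $[x,y]$. $P$ is EL-shellable if it admits an EL-labeling (for some $\Lambda$). *)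

(* Defs.v *)
From HB Require Import structures.
From mathcomp Require Import all_boot all_order all_fingroup.
From mathcomp Require Import boolp classical_sets cardinality.

Set Implicit Arguments.
Unset Strict Implicit.
Unset Printing Implicit Defensive.

Import Order.TTheory.

Local Open Scope group_scope.

Definition eval_word (W : groupType) (n : nat) (s : 'I_n -> W)
    (u : seq 'I_n) : W :=
  \prod_(i <- u) s i.

(* [W] with the generators [S = {gen i | i < n}] (pairwise distinct) is a
   Coxeter system in the sense of Bourbaki: the generators have order 2 and
   [W] is presented by [S] and the relations [(gen i * gen j) ^+ k = 1], where
   [k] is the order of [gen i * gen j] whenever this order is finite.  Letting
   [k] range over all exponents for which the relation holds in [W] (that is,
   over all multiples of the order) gives the same presentation, without having
   to name the Coxeter matrix.  [gen_word] suffices for generation since the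
   generators are involutions. *)
Record coxeter_system (W : groupType) (n : nat) := CoxeterSystem {
  gen :> 'I_n -> W;
  gen_inj : injective gen;
  gen_neq1 : forall i, gen i <> 1;
  gen_sqr : forall i, gen i ^+ 2 = 1;
  gen_word : forall w : W, exists u : seq 'I_n, eval_word gen u = w;
  gen_universal : forall (G : groupType) (f : 'I_n -> G),
    (forall i j k, (gen i * gen j) ^+ k = 1 -> (f i * f j) ^+ k = 1) ->
    exists phi : {multiplicative W -> G}, forall i, phi (gen i) = f i
}.

Section Length.
Context (W : groupType) (n : nat) (S : coxeter_system W n).
Implicit Types (u v w : W).

Definition has_word_of_size w : pred nat :=
  fun k => [exists u : k.-tuple 'I_n, eval_word S u == w].

Lemma has_word_of_sizeP w k :
  reflect (exists2 u : seq 'I_n, size u = k & eval_word S u = w)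
          (has_word_of_size w k).
Proof.
apply: (iffP existsP) => [[u /eqP <-]|[u <- uw]].
  by exists u; rewrite ?size_tuple.
by exists (in_tuple u); apply/eqP.
Qed.

Lemma ex_word_size w : exists k, has_word_of_size w k.
Proof.
have [u uw] := gen_word S w.
by exists (size u); apply/has_word_of_sizeP; exists u.
Qed.

Definition cox_length w : nat := ex_minn (ex_word_size w).

Lemma cox_length_word w :
  exists2 u : seq 'I_n, size u = cox_length w & eval_word S u = w.
Proof. by apply/has_word_of_sizeP; rewrite /cox_length; case: ex_minnP. Qed.

Lemma cox_length_min (u : seq 'I_n) : cox_length (eval_word S u) <= size u.
Proof.
rewrite /cox_length; case: ex_minnP => k _; apply.
by apply/has_word_of_sizeP; exists u.
Qed.

Lemma cox_lengthM u v : cox_length (u * v) <= cox_length u + cox_length v.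
Proof.
have [a <- <-] := cox_length_word u; have [b <- <-] := cox_length_word v.
by rewrite -size_cat /eval_word -big_cat cox_length_min.
Qed.

Lemma cox_length1 : cox_length 1 = 0.
Proof.
by apply/eqP; have := cox_length_min [::]; rewrite /eval_word big_nil leqn0.
Qed.

Lemma cox_length_eq0 w : cox_length w = 0 -> w = 1.
Proof.
have [u <- <-] := cox_length_word w.
by move/size0nil->; rewrite /eval_word big_nil.
Qed.

Definition weak_le u v := cox_length v == cox_length u + cox_length (u^-1 * v).

Lemma weak_le_refl : reflexive weak_le.
Proof. by move=> u; rewrite /weak_le mulVg cox_length1 addn0. Qed.

Lemma weak_le_anti : antisymmetric weak_le.
Proof.
move=> u v /andP[/eqP uv /eqP]; rewrite uv -addnA => /eqP.
rewrite -[X in X == _]addn0 eqn_add2l eq_sym addn_eq0.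
by case/andP => /eqP/cox_length_eq0/(canRL (mulKVg _))-> _; rewrite mulg1.
Qed.

Lemma weak_le_trans : transitive weak_le.
Proof.
move=> v u w /eqP uv /eqP vw; rewrite /weak_le eqn_leq; apply/andP; split.
  by rewrite -{1}(mulKVg u w) cox_lengthM.
rewrite vw uv -addnA leq_add2l.
by have := cox_lengthM (u^-1 * v) (v^-1 * w); rewrite -mulgA mulKVg.
Qed.

End Length.

Definition weak_order (W : groupType) (n : nat) (S : coxeter_system W n) : Type :=
  W.

Fact weak_display : Order.disp_t. Proof. exact: Order.Disp tt tt. Qed.

HB.instance Definition _ (W : groupType) (n : nat) (S : coxeter_system W n) :=
  Choice.on (weak_order S).
HB.instance Definition _ (W : groupType) (n : nat) (S : coxeter_system W n) :=
  Order.Le_isPOrder.Build weak_display (weak_order S)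
    (@weak_le_refl W n S) (@weak_le_anti W n S) (@weak_le_trans W n S).

Section Sortable.
Context (W : groupType) (n : nat) (S : coxeter_system W n).
(* [c] is the numbering of the generators: the [j]-th letter of the Coxeter
   element is [S (c j)]. *)
Variable c : 'S_n.

(* A subword of the half-infinite word [gamma^oo] is the increasing sequence of
   the positions of its letters; the position [(i, j)] is the [j]-th letter of
   the [i]-th copy of [gamma] (both counted from 0). *)
Definition position : Type := (nat * 'I_n)%type.

Definition rank_position (a : position) : nat := (a.1 * n + a.2)%N.

Definition subword_value (p : seq position) : W := \prod_(a <- p) S (c a.2).

Definition reduced_subword (w : W) (p : seq position) : Prop :=
  [/\ sorted ltn (map rank_position p),
      subword_value p = w & size p = cox_length S w].

Definition sorting_word (w : W) (p : seq position) : Prop :=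
  reduced_subword w p /\
  forall q, reduced_subword w q ->
    (map rank_position p <= map rank_position q :> seqlexi nat)%O.

Definition block (p : seq position) (i : nat) : {set 'I_n} :=
  [set c j | j : 'I_n & (i, j) \in p].

(* The blocks after the last nonempty one are empty, so ranging over all [i]
   is the same as stopping at the last block. *)
Definition sortable (w : W) : Prop :=
  exists2 p, sorting_word w p & forall i, block p i.+1 \subset block p i.

Definition cambrian : set (weak_order S) := [set w | sortable w]%classic.

Definition cambrian_interval (x y : weak_order S) : set (weak_order S) :=
  [set z | [/\ cambrian z, (x <= z)%O & (z <= y)%O]]%classic.

End Sortable.

(* Posets below are subsets [P] of a partially ordered type [T], with the
   induced order. *)
Section Shellability.
Context (d : Order.disp_t) (T : porderType d) (P : set T).
Implicit Types (x y z : T).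

Definition finite_bounded_poset : Prop :=
  [/\ finite_set P,
      exists2 a, P a & forall z, P z -> (a <= z)%O
    & exists2 b, P b & forall z, P z -> (z <= b)%O].

Definition covers x y : Prop :=
  [/\ P x, P y, (x < y)%O & ~ exists z, [/\ P z, (x < z)%O & (z < y)%O]].

(* The maximal chains of the interval [x, y] of a finite [P] are the saturated
   chains [x = p_0 <. p_1 <. ... <. p_s = y]; such a chain is represented by
   the sequence [p_1, ..., p_s]. *)
Definition maximal_chain x y (p : seq T) : Prop :=
  path (fun u v => `[< covers u v >]) x p /\ last x p = y.

Section Labeling.
(* Only the values of [lam] on the covering relations of [P] matter. *)
Context (dL : Order.disp_t) (L : porderType dL) (lam : T -> T -> L).

Definition chain_label x (p : seq T) : seq L := pairmap lam x p.

Definition rising x (p : seq T) : Prop := sorted <%O (chain_label x p).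

Definition EL_labeling : Prop :=
  forall x y, P x -> P y -> (x <= y)%O ->
  exists p, [/\ maximal_chain x y p, rising x p,
    forall q, maximal_chain x y q -> rising x q -> q = p
  & forall q, maximal_chain x y q ->
      (chain_label x p <= chain_label x q :> seqlexi L)%O].

End Labeling.

Definition EL_shellable : Prop :=
  finite_bounded_poset /\
  exists (dL : Order.disp_t) (L : porderType dL) (lam : T -> T -> L),
    EL_labeling lam.

End Shellability.

(* Main.v *)
(* Let [s] be the first letter of the Coxeter element.  If [s <= w], then [w] is
   sortable iff [s w] is sortable for the Coxeter element with [s] moved to the
   end; otherwise [w] is sortable iff it lies in the parabolic subgroup omitting
   [s] and is sortable for that rotated element.  Label a cover [u < v] by the
   least position of the sorting word of [v] that is not used by [u], and induct
   along this recursion.  The labels of an interval [u, v] only change in a trivial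
   way unless [s <= v] and not [s <= u].  In that case the join [z] of [s] and [u]
   in the weak order is sortable, covers [u] among the sortable elements, and every
   rising chain must start with the step from [u] to [z].

   The two facts on [z] are read off from the reflection representation.  That [z]
   covers [u] holds because the parabolic part of [z] is [u].  That [z] is sortable
   follows from the theory of Reading and Speyer: an element projects to a sortable
   [p] iff it lies in the cone of [p], whose walls are the roots of the skipped
   letters, and the signs of a skew-symmetric form, invariant under rotation of the
   Coxeter element, control the wall [s]. *)

Require Import Defs.
From HB Require Import structures.
From mathcomp Require Import all_boot all_order all_algebra all_fingroup.
From mathcomp Require Import boolp classical_sets cardinality.
From mathcomp Require Import Rstruct.
From mathcomp Require Import ring lra zify.

Set Implicit Arguments.
Unset Strict Implicit.
Unset Printing Implicit Defensive.

Import Order.TTheory GRing.Theory Num.Theory.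

Local Open Scope ring_scope.

(** * The reflection representation *)

(** Two facts lean on each other: projections are maximal ([projk_max]), and the join of the first
    letter with a sortable element is sortable ([join_gen_sort]). One induction on the length of the
    projected element proves both: for a join of length at most [l], maximality is only applied to
    elements shorter than [l].

    Skipping a letter does not shorten the element, so the recursion along the word does not follow
    the length. This is why sortability, projections, walls and label positions are inductive
    relations, on whose derivations the proofs induct.

    The field is kept abstract: a finite order [m] enters only through signs and periodicity of
    Chebyshev values at cos (pi / m), supplied by the real numbers at the end. *)

Section InvertibleMatrices.
Context (F : fieldType) (n : nat).

(** The general linear group packed as a [groupType], to serve as the target in [gen_universal]. *)
Definition invertible_mx := {A : 'M[F]_n | A \in unitmx}.
HB.instance Definition _ := Choice.on invertible_mx.

Let one : invertible_mx := exist _ 1%:M (unitmx1 F n).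

Fact inv_subproof (A : invertible_mx) : invmx (val A) \in unitmx.
Proof. by rewrite unitmx_inv (valP A). Qed.
Let inv A : invertible_mx := exist _ (invmx (val A)) (inv_subproof A).

Fact mul_subproof (A B : invertible_mx) : val A *m val B \in unitmx.
Proof. by rewrite unitmx_mul (valP A) (valP B). Qed.
Let mul A B : invertible_mx := exist _ (val A *m val B) (mul_subproof A B).

Fact imx_mulA : associative mul.
Proof. by move=> A B C; apply: val_inj; rewrite /= mulmxA. Qed.
Fact imx_mul1 : left_id one mul.
Proof. by move=> A; apply: val_inj; rewrite /= mul1mx. Qed.
Fact imx_mulr1 : right_id one mul.
Proof. by move=> A; apply: val_inj; rewrite /= mulmx1. Qed.
Fact imx_mulV : left_inverse one inv mul.
Proof. by move=> A; apply: val_inj; rewrite /= mulVmx ?(valP A). Qed.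
Fact imx_mulrV : right_inverse one inv mul.
Proof. by move=> A; apply: val_inj; rewrite /= mulmxV ?(valP A). Qed.

HB.instance Definition _ := isGroup.Build invertible_mx
  imx_mulA imx_mul1 imx_mulr1 imx_mulV imx_mulrV.

Lemma val_imxM (A B : invertible_mx) : val (A * B)%g = val A *m val B.
Proof. by []. Qed.

Lemma val_imx1 : val (1%g : invertible_mx) = 1%:M.
Proof. by []. Qed.

End InvertibleMatrices.

(** * Chebyshev values *)

Section Chebyshev.
Context (R : realFieldType).

(** Pairs of consecutive values make the two-term recurrence structural. [cheb c k] is U_(k-1) at
    [c], a Chebyshev polynomial of the second kind. *)
Fixpoint cheb2 (c : R) (k : nat) : R * R :=
  if k is k'.+1 then let: (x, y) := cheb2 c k' in (y, 2 * c * y - x)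
  else (0, 1).

Definition cheb c k : R := (cheb2 c k).1.

Lemma chebSS c k : cheb c k.+2 = 2 * c * cheb c k.+1 - cheb c k.
Proof. by rewrite /cheb /=; case: (cheb2 c k) => x y. Qed.

Lemma cheb0 c : cheb c 0 = 0. Proof. by []. Qed.
Lemma cheb1 c : cheb c 1 = 1. Proof. by []. Qed.

Lemma cheb_1 k : cheb 1 k = k%:R.
Proof.
suff: cheb 1 k = k%:R /\ cheb 1 k.+1 = k.+1%:R by case.
elim: k => [|k [IH1 IH2]]; first by rewrite cheb0 cheb1.
by rewrite chebSS IH1 IH2; split=> //; rewrite -[k.+2]addn2 -addn1 !natrD; ring.
Qed.

(* The values of [cos (pi / m)] needed for the reflection representation:
   [cheb c k] is [sin (k t) / sin t] for [c = cos t]. *)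
Definition is_cos_pi_over (m : nat) (c : R) : Prop :=
  [/\ 0 <= c, c < 1, forall k, (k <= m)%N -> 0 <= cheb c k,
      cheb c (m + m) = 0 & cheb c (m + m).+1 = 1].

End Chebyshev.

(** * The bilinear form and the action of the group by reflections *)

Section Geometric.
Context (R : realFieldType) (cosm : nat -> R).
Hypothesis cosmP : forall m, (1 < m)%N -> is_cos_pi_over m (cosm m).
Context (W : groupType) (n : nat) (S : coxeter_system W n).
Implicit Types (i j s t : 'I_n) (u v w : W).

Notation len := (cox_length S).

Lemma gen_mulgg i : (S i * S i)%g = 1%g.
Proof. by rewrite -(gen_sqr S i) expg2. Qed.

Lemma gen_invg i : (S i)^-1%g = S i.
Proof. exact: mulg1_eq (gen_mulgg i). Qed.

Lemma gen_mulKg i w : (S i * (S i * w))%g = w.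
Proof. by rewrite mulgA gen_mulgg mul1g. Qed.

Definition finite_order i j : Prop :=
  exists k, (0 < k)%N && ((S i * S j) ^+ k == 1)%g.

(** The value 0 stands for infinite order, so that [cox_orderX] and [cox_order_dvd] need no case
    distinction. *)
Definition cox_order i j : nat :=
  if pselect (finite_order i j) is left h then ex_minn h else 0.

Lemma cox_orderX i j : ((S i * S j) ^+ cox_order i j = 1)%g.
Proof.
rewrite /cox_order; case: pselect => [h|_]; last by rewrite expg0.
by case: ex_minnP => m /andP[_ /eqP].
Qed.

Lemma cox_order_gt0 i j k : (0 < k)%N -> ((S i * S j) ^+ k = 1)%g ->
  (0 < cox_order i j)%N.
Proof.
move=> k0 ijk; rewrite /cox_order; case: pselect => [h|[]].
  by case: ex_minnP => m /andP[].
by exists k; rewrite k0 ijk eqxx.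
Qed.

Lemma cox_order_dvd i j k : ((S i * S j) ^+ k = 1)%g -> (cox_order i j %| k)%N.
Proof.
move=> ijk; case: (posnP k) => [->|k0]; first by rewrite dvdn0.
have m0 := cox_order_gt0 k0 ijk; rewrite /dvdn; apply: contraT => r0.
have : ((S i * S j) ^+ (k %% cox_order i j) = 1)%g.
  move: ijk; rewrite {1}(divn_eq k (cox_order i j)) mulnC expgnDr expgnA.
  by rewrite cox_orderX expg1n mul1g.
move: r0 (ltn_pmod k m0); rewrite -lt0n.
set r := (k %% _)%N => r0; rewrite ltnNge => /negP rm er; case: rm.
rewrite /cox_order; case: pselect => [h|[]].
  by case: ex_minnP => m _; apply; rewrite r0 er eqxx.
by exists r; rewrite r0 er eqxx.
Qed.

Lemma cox_orderC i j : cox_order i j = cox_order j i.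
Proof.
have h a b : ((S a * S b) ^+ cox_order b a = 1)%g.
  have <- : ((S b * S a)^-1 = S a * S b)%g by rewrite invMg !gen_invg.
  by rewrite expVgn cox_orderX invg1.
by apply/eqP; rewrite eqn_dvd !cox_order_dvd.
Qed.

Lemma cox_order_neq i j : i != j -> cox_order i j != 1%N.
Proof.
apply: contraNneq => m1; have := cox_orderX i j; rewrite m1 expg1 => h.
by apply/eqP/(gen_inj (c := S)); apply: (mulIg (S j)); rewrite h gen_mulgg.
Qed.

(** Infinite order gets 1, the limit of cos (pi / m). [cartan] is twice the usual form, so that
    roots have square norm 2 and [refl] needs no division. *)
Definition half_cos i j : R :=
  if cox_order i j == 0%N then 1 else cosm (cox_order i j).

Definition cartan i j : R := if i == j then 2 else - (2 * half_cos i j).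

Lemma cartanC i j : cartan i j = cartan j i.
Proof. by rewrite /cartan eq_sym /half_cos cox_orderC. Qed.

Lemma cartan_diag i : cartan i i = 2. Proof. by rewrite /cartan eqxx. Qed.

Lemma half_cos_ge0 i j : i != j -> 0 <= half_cos i j.
Proof.
move=> ij; rewrite /half_cos; case: eqP => [_|/eqP m0]; first by lra.
have := cox_order_neq ij; case: (cox_order i j) m0 => [//|[//|m _ _]].
by have [] := @cosmP m.+2 isT.
Qed.

Lemma cartan_le0 i j : i != j -> cartan i j <= 0.
Proof.
by move=> ij; rewrite /cartan (negPf ij); have := half_cos_ge0 ij; lra.
Qed.

Lemma cheb_half_cos_ge0 i j k : i != j ->
  (cox_order i j = 0 \/ k <= cox_order i j)%N -> 0 <= cheb (half_cos i j) k.
Proof.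
move=> ij; rewrite /half_cos; case: eqP => [_ _|/eqP m0 [/eqP m1|]].
- by rewrite cheb_1 ler0n.
- by rewrite m1 in m0.
by have := cox_order_neq ij; case: (cox_order i j) m0 => [//|[//|m _ _]];
  have [_ _ + _ _] := @cosmP m.+2 isT; apply.
Qed.

Notation vec := 'cV[R]_n.
Implicit Types (x y z : vec).

Definition sroot i : vec := delta_mx i 0.

Lemma srootE i j : sroot i j 0 = (j == i)%:R.
Proof. by rewrite mxE eqxx andbT. Qed.

Definition form x y : R := \sum_i \sum_j x i 0 * cartan i j * y j 0.

Lemma formC x y : form x y = form y x.
Proof.
rewrite /form exchange_big; apply: eq_bigr => i _; apply: eq_bigr => j _.
by rewrite cartanC mulrAC [RHS]mulrAC [y i 0 * _]mulrC.
Qed.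

Lemma formDl x y z : form (x + y) z = form x z + form y z.
Proof.
rewrite /form -big_split; apply: eq_bigr => i _; rewrite -big_split.
by apply: eq_bigr => j _; rewrite !mxE !mulrDl.
Qed.

Lemma formZl a x z : form (a *: x) z = a * form x z.
Proof.
rewrite /form mulr_sumr; apply: eq_bigr => i _; rewrite mulr_sumr.
by apply: eq_bigr => j _; rewrite !mxE !mulrA.
Qed.

Lemma formNl x z : form (- x) z = - form x z.
Proof. by rewrite -scaleN1r formZl mulN1r. Qed.

Lemma formDr x y z : form z (x + y) = form z x + form z y.
Proof. by rewrite formC formDl ![form _ z]formC. Qed.

Lemma formZr a x z : form z (a *: x) = a * form z x.
Proof. by rewrite formC formZl formC. Qed.

Lemma formNr x z : form z (- x) = - form z x.
Proof. by rewrite formC formNl formC. Qed.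

Lemma form_srootr x i : form x (sroot i) = \sum_j x j 0 * cartan j i.
Proof.
apply: eq_bigr => j _; rewrite (bigD1 i) //= big1 ?addr0.
  by rewrite srootE eqxx mulr1.
by move=> k /negPf ki; rewrite srootE ki mulr0.
Qed.

Lemma form_sroot i j : form (sroot i) (sroot j) = cartan i j.
Proof.
rewrite form_srootr (bigD1 i) //= big1 ?addr0 ?srootE ?eqxx ?mul1r //.
by move=> k /negPf ki; rewrite srootE ki mul0r.
Qed.

Lemma vecE x : x = \sum_i x i 0 *: sroot i.
Proof.
apply/matrixP => i j; rewrite ord1 summxE (bigD1 i) //= big1 ?addr0.
  by rewrite mxE srootE eqxx mulr1.
by move=> k /negPf ki; rewrite mxE srootE eq_sym ki mulr0.
Qed.

Definition refl i x : vec := x - form x (sroot i) *: sroot i.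

Lemma reflD i x y : refl i (x + y) = refl i x + refl i y.
Proof. by rewrite /refl formDl scalerDl opprD addrACA. Qed.

Lemma reflZ i a x : refl i (a *: x) = a *: refl i x.
Proof. by rewrite /refl formZl scalerBr scalerA. Qed.

Lemma reflK i : involutive (refl i).
Proof.
move=> x; rewrite /refl formDl formNl formZl form_sroot cartan_diag.
rewrite -addrA -opprD -scalerDl.
have -> : form x (sroot i) + (form x (sroot i) - form x (sroot i) * 2) = 0 by ring.
by rewrite scale0r subr0.
Qed.

Lemma refl_sroot i : refl i (sroot i) = - sroot i.
Proof.
by rewrite /refl form_sroot cartan_diag scaler_nat mulr2n opprD addNKr.
Qed.

Lemma refl_coord i j x : j != i -> refl i x j 0 = x j 0.
Proof. by move=> ji; rewrite !mxE (negPf ji) /= mulr0 subr0. Qed.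

Lemma form_refl i x y : form (refl i x) (refl i y) = form x y.
Proof.
rewrite /refl !(formDl, formDr, formNl, formNr, formZl, formZr).
by rewrite form_sroot cartan_diag [form (sroot i) y]formC; ring.
Qed.

(* Two adjacent terms of the Chebyshev sequence are the coordinates of the
   roots of a dihedral subsystem. *)
Lemma refl_cheb i j k (c := half_cos i j) : i != j ->
  refl j (cheb c k.+1 *: sroot i + cheb c k *: sroot j)
  = cheb c k.+1 *: sroot i + cheb c k.+2 *: sroot j.
Proof.
move=> ij; rewrite {1}/refl formDl !formZl !form_sroot cartan_diag.
rewrite /cartan (negPf ij) -/c -addrA -scalerBl chebSS; congr (_ + _ *: _).
by ring.
Qed.

Definition rot i j x := refl i (refl j x).

Lemma rotK i j : cancel (rot i j) (rot j i).
Proof. by move=> x; rewrite /rot !reflK. Qed.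

Lemma half_cosC i j : half_cos i j = half_cos j i.
Proof. by rewrite /half_cos cox_orderC. Qed.

Lemma rot_cheb i j k (c := half_cos i j) : i != j ->
  iter k (rot i j) (sroot i)
  = cheb c (k + k).+1 *: sroot i + cheb c (k + k) *: sroot j.
Proof.
move=> ij; elim: k => [|k IH].
  by rewrite addn0 /= cheb0 cheb1 scale1r scale0r addr0.
rewrite iterS IH /rot refl_cheb // -/c !addSn !addnS addrC [RHS]addrC.
by rewrite /c half_cosC refl_cheb // eq_sym.
Qed.

Lemma iter_rotK i j k x : iter k (rot i j) (iter k (rot j i) x) = x.
Proof.
by elim: k x => // k IH x; rewrite iterSr (iterS k (rot j i)) rotK.
Qed.

Lemma rotD i j x y : rot i j (x + y) = rot i j x + rot i j y.
Proof. by rewrite /rot !reflD. Qed.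

Lemma rotZ i j a x : rot i j (a *: x) = a *: rot i j x.
Proof. by rewrite /rot !reflZ. Qed.

Lemma iter_rotD i j k x y :
  iter k (rot i j) (x + y) = iter k (rot i j) x + iter k (rot i j) y.
Proof. by elim: k => // k IH; rewrite !iterS IH rotD. Qed.

Lemma iter_rotZ i j k a x : iter k (rot i j) (a *: x) = a *: iter k (rot i j) x.
Proof. by elim: k => // k IH; rewrite !iterS IH rotZ. Qed.

(** For finite order the form is nondegenerate on the plane of the two roots, so a vector splits
    into a part in this plane and a part orthogonal to both roots, which the rotation fixes. In the
    plane, the periodicity of [cheb] fixes one root, and applied to the inverse rotation it fixes
    the other. *)
Lemma rot_order i j k x : ((S i * S j) ^+ k = 1)%g -> iter k (rot i j) x = x.
Proof.
move=> ijk; case: (posnP k) => [->//|k0].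
have m0 := cox_order_gt0 k0 ijk.
have /dvdnP[q ->] := cox_order_dvd ijk.
suff fix_m y : iter (cox_order i j) (rot i j) y = y.
  by elim: q => // q IH; rewrite mulSn iterD IH fix_m.
have [<-{ijk m0}|ij] := eqVneq i j.
  have rii z : rot i i z = z by rewrite /rot reflK.
  by elim: (cox_order i i) => // m IH; rewrite iterS IH rii.
have fix_root a b : a != b -> (0 < cox_order a b)%N ->
    iter (cox_order a b) (rot a b) (sroot a) = sroot a.
  move=> ab ab0; rewrite rot_cheb // /half_cos eqn0Ngt ab0 /=.
  have := cox_order_neq ab; case: (cox_order a b) ab0 => [//|[//|m _ _]].
  have [_ _ _ -> ->] := @cosmP m.+2 isT.
  by rewrite scale1r scale0r addr0.
have fix_i := fix_root _ _ ij m0.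
have fix_j : iter (cox_order i j) (rot i j) (sroot j) = sroot j.
  rewrite -{1}[sroot j](fix_root j i) ?[cox_order j i]cox_orderC //.
    by rewrite iter_rotK.
  by rewrite eq_sym.
have [c0 c1] : 0 <= half_cos i j /\ half_cos i j < 1.
  rewrite /half_cos eqn0Ngt m0 /=.
  have := cox_order_neq ij; case: (cox_order i j) m0 => [//|[//|m _ _]].
  by have [] := @cosmP m.+2 isT.
pose c := half_cos i j; pose p := form y (sroot i); pose q' := form y (sroot j).
have d0 : 1 - c ^+ 2 != 0.
  have -> : 1 - c ^+ 2 = (1 - c) * (1 + c) by ring.
  by rewrite gt_eqF // mulr_gt0 // /c; lra.
(* The coordinates of the orthogonal projection of [y] to the plane, from the Gram system of
   determinant 4 (1 - c^2). *)
pose X := (p + c * q') / (2 * (1 - c ^+ 2)).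
pose Y := (q' + c * p) / (2 * (1 - c ^+ 2)).
pose pl := X *: sroot i + Y *: sroot j; pose y' := y - pl.
have cij : cartan i j = - (2 * c) by rewrite /cartan (negPf ij).
have fi : form y' (sroot i) = 0.
  rewrite /y' /pl formDl formNl formDl !formZl !form_sroot cartan_diag.
  by rewrite [cartan j i]cartanC cij -/p /X /Y; field.
have fj : form y' (sroot j) = 0.
  rewrite /y' /pl formDl formNl formDl !formZl !form_sroot cartan_diag.
  by rewrite cij -/q' /X /Y; field.
have fy' : iter (cox_order i j) (rot i j) y' = y'.
  have r1 : rot i j y' = y' by rewrite /rot /refl fj scale0r subr0 fi scale0r subr0.
  by elim: (cox_order i j) => // m IH; rewrite iterS IH r1.
have -> : y = y' + pl by rewrite /y' subrK.
by rewrite iter_rotD fy' /pl iter_rotD !iter_rotZ fix_i fix_j.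
Qed.

Definition refl_mx i : 'M[R]_n := 1%:M - sroot i *m (\row_j cartan j i).

Lemma refl_mxE i x : refl_mx i *m x = refl i x.
Proof.
rewrite /refl_mx mulmxBl mul1mx -mulmxA /refl form_srootr; congr (_ - _).
apply/matrixP => a b; rewrite ord1 mxE big_ord1 !mxE mulrC; congr (_ * _).
by apply: eq_bigr => j _; rewrite mxE mulrC.
Qed.

Lemma col_eqP (A B : 'M[R]_n) : (forall x : vec, A *m x = B *m x) -> A = B.
Proof.
move=> AB; apply/matrixP => i j; have := congr1 (fun x : vec => x i 0) (AB (sroot j)).
have aux (C : 'M[R]_n) : (C *m sroot j) i 0 = C i j.
  rewrite mxE (bigD1 j) //= big1 ?addr0 ?srootE ?eqxx ?mulr1 //.
  by move=> k /negPf kj; rewrite srootE kj mulr0.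
by rewrite !aux.
Qed.

Fact refl_mx_unit i : refl_mx i \in unitmx.
Proof.
have : refl_mx i *m refl_mx i = 1%:M.
  by apply: col_eqP => x; rewrite -mulmxA !refl_mxE reflK mul1mx.
by move=> /mulmx1_unit[].
Qed.

Definition refl_imx i : invertible_mx R n := exist _ (refl_mx i) (refl_mx_unit i).

Lemma val_rot i j k x :
  val ((refl_imx i * refl_imx j) ^+ k)%g *m x = iter k (rot i j) x.
Proof.
elim: k => [|k IH]; first by rewrite expg0 val_imx1 mul1mx.
by rewrite expgS !val_imxM -!mulmxA IH /= !refl_mxE.
Qed.

Fact refl_relations i j k : ((S i * S j) ^+ k = 1)%g ->
  ((refl_imx i * refl_imx j) ^+ k = 1)%g.
Proof.
move=> ijk; apply: val_inj; apply: col_eqP => x.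
by rewrite val_rot rot_order // val_imx1 mul1mx.
Qed.

(** The presentation of [W] enters here and nowhere else. *)
Definition rep : {multiplicative W -> invertible_mx R n} :=
  projT1 (cid (gen_universal refl_relations)).

Definition wact w x : vec := val (rep w) *m x.

Lemma wactM u v x : wact (u * v)%g x = wact u (wact v x).
Proof. by rewrite /wact gmulfM mulmxA. Qed.

Lemma wact1 x : wact 1%g x = x.
Proof.
rewrite /wact (_ : rep 1%g = 1%g) ?val_imx1 ?mul1mx //.
by apply: (mulgI (rep 1%g)); rewrite -gmulfM !mulg1.
Qed.

Lemma wact_gen i x : wact (S i) x = refl i x.
Proof. by rewrite /wact /rep; case: cid => f /= ->; rewrite refl_mxE. Qed.

Lemma wactK w : cancel (wact w) (wact w^-1%g).
Proof. by move=> x; rewrite -wactM mulVg wact1. Qed.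

Lemma wactVK w : cancel (wact w^-1%g) (wact w).
Proof. by move=> x; rewrite -wactM mulgV wact1. Qed.

Lemma wactD w x y : wact w (x + y) = wact w x + wact w y.
Proof. exact: mulmxDr. Qed.

Lemma wactZ w a x : wact w (a *: x) = a *: wact w x.
Proof. exact: esym (scalemxAr _ _ _). Qed.

Lemma wactN w x : wact w (- x) = - wact w x.
Proof. exact: mulmxN. Qed.

Lemma wact_sum w (I : finType) (F : I -> vec) :
  wact w (\sum_i F i) = \sum_i wact w (F i).
Proof. exact: mulmx_sumr. Qed.

Lemma wact_eval (P : W -> Prop) : P 1%g -> (forall i w, P w -> P (S i * w)%g) ->
  forall w, P w.
Proof.
move=> P1 PS w; have [u <-] := gen_word S w; rewrite /eval_word.
by elim: u => [|i u IH]; rewrite ?big_nil // big_cons; apply: PS.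
Qed.

Lemma form_wact w x y : form (wact w x) (wact w y) = form x y.
Proof.
elim/wact_eval: w x y => [|i w IH] x y; first by rewrite !wact1.
by rewrite !wactM !wact_gen form_refl.
Qed.

(** * Lengths and positive roots *)

Lemma len_gen i : (len (S i) <= 1)%N.
Proof. by have := cox_length_min S [:: i]; rewrite /eval_word big_seq1. Qed.

Lemma len_genM i w : (len (S i * w)%g <= (len w).+1)%N.
Proof.
by apply: leq_trans (cox_lengthM _ _ _) _; rewrite -addn1 addnC leq_add2l len_gen.
Qed.

Lemma len_genM_ge i w : (len w <= (len (S i * w)%g).+1)%N.
Proof. by rewrite -{1}[w](gen_mulKg i) len_genM. Qed.

Lemma lenV w : len w^-1%g = len w.
Proof.
have lenV_le v : (len v^-1%g <= len v)%N.
  have [u <- <-] := cox_length_word S v; rewrite -(size_rev u).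
  suff -> : ((eval_word S u)^-1 = eval_word S (rev u))%g by apply: cox_length_min.
  rewrite /eval_word; elim: u => [|i u IH]; first by rewrite !big_nil invg1.
  by rewrite rev_cons -cats1 big_cons big_cat big_seq1 invMg IH gen_invg.
by apply/eqP; rewrite eqn_leq lenV_le -{1}[w]invgK lenV_le.
Qed.

Lemma left_descent w : w <> 1%g ->
  exists i, (len (S i * w)%g).+1 = len w.
Proof.
have [u uw uE] := cox_length_word S w; rewrite -{w}uE in uw *.
case: u uw => [|i u] /= uw; first by rewrite /eval_word big_nil.
move=> _; exists i; apply/eqP; rewrite eqn_leq len_genM_ge andbT -uw ltnS.
by rewrite /eval_word big_cons gen_mulKg cox_length_min.
Qed.

(** * Alternating words and the sign of roots *)

Fixpoint alt i j k : W := if k is k'.+1 then (S i * alt j i k')%g else 1%g.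

Lemma altS i j k : alt i j k.+1 = (S i * alt j i k)%g. Proof. by []. Qed.

Lemma alt_len i j k : (len (alt i j k) <= k)%N.
Proof.
elim: k i j => [|k IH] i j; first by rewrite cox_length1.
by apply: leq_trans (len_genM _ _) _; rewrite ltnS.
Qed.

Lemma altD i j p q :
  alt i j (p + q) = (alt i j p * if odd p then alt j i q else alt i j q)%g.
Proof.
elim: p i j => [|p IH] i j; first by rewrite mul1g.
by rewrite addSn !altS IH mulgA /=; case: (odd p).
Qed.

Lemma altSr i j k : alt i j k.+1 = (alt i j k * S (if odd k then j else i))%g.
Proof. by rewrite -addn1 altD; case: (odd k); rewrite altS mulg1. Qed.

Lemma altV i j k : ((alt i j k)^-1 = if odd k then alt i j k else alt j i k)%g.
Proof.
elim: k i j => [|k IH] i j; first by rewrite invg1.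
by rewrite {1}altSr invMg gen_invg IH oddS if_neg; case: (odd k).
Qed.

Lemma alt2 i j m : alt i j (m + m) = ((S i * S j) ^+ m)%g.
Proof.
elim: m => [|m IH]; first by rewrite expg0.
by rewrite addSn addnS !altS IH mulgA expgS.
Qed.

(** The braid relation; for infinite order both sides are 1. *)
Lemma alt_order i j : alt i j (cox_order i j) = alt j i (cox_order i j).
Proof.
set m := cox_order i j.
have h : (alt i j (m + m) = 1)%g by rewrite alt2 cox_orderX.
apply: (mulIg (alt j i m)^-1)%g; rewrite mulgV altV -h altD.
by case: (odd m).
Qed.

(** Strip the longest alternating prefix starting with [t]. The letter that would continue it is not
    a descent of [v] by maximality; the last letter of the prefix is none since cancelling it would
    shorten [w]. *)
Lemma alt_prefix s t w : (len (S t * w)%g < len w)%N ->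
  exists k v, [/\ w = (alt t s k.+1 * v)%g, len w = (k.+1 + len v)%N,
    (len v <= len (S s * v)%g)%N & (len v <= len (S t * v)%g)%N].
Proof.
move=> tw; pose P k := len w == (k + len ((alt t s k)^-1 * w)%g)%N.
have P1 : P 1%N.
  rewrite /P altS mulg1 gen_invg add1n eq_sym eqn_leq len_genM_ge andbT.
  exact: tw.
have Pmax k : P k -> (k <= len w)%N by move/eqP ->; rewrite leq_addr.
have [] := ex_maxnP (ex_intro _ 1%N P1) Pmax.
case=> [|k] Pk maxk; first by have := maxk _ P1.
exists k; set v := ((alt t s k.+1)^-1 * w)%g; exists v.
have wE : w = (alt t s k.+1 * v)%g by rewrite mulVKg.
have lw : len w = (k.+1 + len v)%N by apply/eqP.
(* [q] is the letter that would continue the prefix, [q'] its last letter. *)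
pose q := if odd k.+1 then s else t; pose q' := if odd k then s else t.
have h1 : (len v <= len (S q * v)%g)%N.
  rewrite leqNgt; apply/negP => lt; suff /maxk : P k.+2 by rewrite ltnn.
  rewrite /P altSr invMg gen_invg -mulgA -/v lw -/q.
  by rewrite [X in _ == X]addSnnS eqn_add2l eqn_leq lt len_genM_ge.
have h2 : (len v <= len (S q' * v)%g)%N.
  rewrite leqNgt; apply/negP => lt.
  have : (len w <= k + len (S q' * v)%g)%N.
    rewrite wE altSr -mulgA; apply: leq_trans (cox_lengthM _ _ _) _.
    by rewrite leq_add2r alt_len.
  by rewrite lw; move: lt; lia.
by split=> //; move: h1 h2; rewrite /q /q' /=; case: (odd k).
Qed.

Definition nneg x : Prop := forall i, 0 <= x i 0.

Lemma nnegD x y : nneg x -> nneg y -> nneg (x + y).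
Proof. by move=> x0 y0 i; rewrite mxE addr_ge0. Qed.

Lemma nnegZ a x : 0 <= a -> nneg x -> nneg (a *: x).
Proof. by move=> a0 x0 i; rewrite mxE mulr_ge0. Qed.

Lemma nneg_sroot i : nneg (sroot i).
Proof. by move=> j; rewrite srootE ler0n. Qed.

Lemma nneg_sum (I : finType) (F : I -> vec) :
  (forall k, nneg (F k)) -> nneg (\sum_k F k).
Proof. by move=> F0 i; rewrite summxE sumr_ge0 // => k _; apply: F0. Qed.

(** Each letter advances the index by one and exchanges the two roots, hence the result up to a
    swap. *)
Lemma wact_altV_cheb s t k p (c := half_cos s t) : s != t ->
  exists a b, [/\ a = s /\ b = t \/ a = t /\ b = s &
    wact (alt t s k)^-1%g (cheb c p.+1 *: sroot s + cheb c p *: sroot t)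
    = cheb c (p + k).+1 *: sroot a + cheb c (p + k) *: sroot b].
Proof.
elim: k s t p @c => [|k IH] s t p c st.
  by exists s, t; split; [left|rewrite invg1 wact1 addn0].
have ts : t != s by rewrite eq_sym.
have [a [b [ab e]]] := IH _ _ p.+1 ts; exists a, b; split; first by tauto.
rewrite altS invMg wactM gen_invg wact_gen refl_cheb // [X in wact _ X]addrC.
by move: e; rewrite -half_cosC -/c => ->; rewrite addSn addnS.
Qed.

(** Induction on the length. Once the alternating prefix in [s] and a left descent [t] is removed,
    the simple root has become a combination of the two simple roots with Chebyshev coefficients,
    and the remaining factor keeps both of them nonnegative. *)
Theorem wact_sroot_nneg s w : (len w <= len (S s * w)%g)%N ->
  nneg (wact w^-1%g (sroot s)).
Proof.
elim/ltn_ind: (len w) {-2}w (erefl (len w)) s => l IH {}w lw s sw.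
have [w1|wn1] := pselect (w = 1%g).
  by rewrite w1 invg1 wact1; apply: nneg_sroot.
have [t tw] := left_descent wn1.
have st : s != t by apply: contraTneq sw => ->; rewrite -ltnNge -tw.
have [|k [v [wE wl sv tv]]] := @alt_prefix s t w; first by rewrite -tw.
have vl : (len v < l)%N by rewrite -lw wl; lia.
have IHv q : q = s \/ q = t -> nneg (wact v^-1%g (sroot q)).
  by case=> ->; apply: (IH _ vl).
(* A longer prefix could be rewritten by the braid relation to start with [s], making [s] a descent
   of [w]. The bound keeps the Chebyshev coefficients nonnegative. *)
have kb : (cox_order s t = 0 \/ k.+2 <= cox_order s t)%N.
  case: (posnP (cox_order s t)) => [|m0]; [by left|right].
  rewrite ltnNge; apply/negP => mk; move: sw; rewrite leqNgt => /negP; apply.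
  rewrite wl wE -(subnKC mk) altD [cox_order _ _]cox_orderC alt_order.
  rewrite [cox_order t s]cox_orderC.
  case: (cox_order s t) m0 mk => // m _ mk; rewrite altS -!mulgA gen_mulKg.
  apply: leq_ltn_trans (cox_lengthM _ _ _) _.
  apply: leq_ltn_trans (leq_add (alt_len _ _ _) (cox_lengthM _ _ _)) _.
  set X := (if _ then _ else _).
  have : (len X <= k.+1 - m.+1)%N by rewrite /X; case: ifP => _; apply: alt_len.
  by move: mk; lia.
have [a [b [ab e]]] := wact_altV_cheb k.+1 0 st.
rewrite wE invMg wactM.
have -> : sroot s = cheb (half_cos s t) 1 *: sroot s + cheb (half_cos s t) 0 *: sroot t.
  by rewrite cheb0 cheb1 scale1r scale0r addr0.
rewrite e wactD !wactZ; apply: nnegD; apply: nnegZ.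
- by apply: (cheb_half_cos_ge0 st).
- by apply: IHv; tauto.
- by apply: (cheb_half_cos_ge0 st); move: kb; lia.
- by apply: IHv; tauto.
Qed.

(** * Inversions and the weak order *)

Definition root x : Prop := exists w i, x = wact w (sroot i).

Lemma root_sroot i : root (sroot i).
Proof. by exists 1%g, i; rewrite wact1. Qed.

Lemma root_wact w x : root x -> root (wact w x).
Proof. by case=> v [i ->]; exists (w * v)%g, i; rewrite wactM. Qed.

Lemma root_refl i x : root x -> root (refl i x).
Proof. by move=> /(root_wact (S i)); rewrite wact_gen. Qed.

Lemma root_opp x : root x -> root (- x).
Proof.
case=> w [i ->]; exists (w * S i)%g, i.
by rewrite wactM wact_gen refl_sroot wactN.
Qed.

Lemma form_root x : root x -> form x x = 2.
Proof. by case=> w [i ->]; rewrite form_wact form_sroot cartan_diag. Qed.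

Lemma root_sign x : root x -> nneg x \/ nneg (- x).
Proof.
case=> w [i ->]; rewrite -[w]invgK.
have [le|lt] := leqP (len w^-1%g) (len (S i * w^-1)%g).
  by left; apply: wact_sroot_nneg.
right; have := @wact_sroot_nneg i (S i * w^-1)%g.
rewrite gen_mulKg invMg gen_invg wactM wact_gen refl_sroot wactN.
by apply; apply: ltnW.
Qed.

Lemma nneg_anti x : nneg x -> nneg (- x) -> x = 0.
Proof.
move=> x0 x1; apply/matrixP => i j; rewrite ord1 mxE; apply/le_anti.
by rewrite x0 andbT -oppr_ge0; have := x1 i; rewrite mxE.
Qed.

Lemma root_neq0 x : root x -> x <> 0.
Proof.
move=> /form_root + x0; rewrite x0 -(scale0r 0) formZl mul0r => /eqP.
by rewrite eq_sym pnatr_eq0.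
Qed.

Definition posroot x : Prop := root x /\ nneg x.

Lemma posroot_sroot i : posroot (sroot i).
Proof. by split; [apply: root_sroot|apply: nneg_sroot]. Qed.

Lemma posroot_not_neg x : posroot x -> ~ nneg (- x).
Proof. by move=> [rx x0] x1; apply: (root_neq0 rx); apply: nneg_anti. Qed.

Lemma root_neg x : root x -> ~ nneg x -> posroot (- x).
Proof. by move=> rx x0; split; [apply: root_opp|have [] := root_sign rx]. Qed.

Lemma root_pos x : root x -> ~ nneg (- x) -> posroot x.
Proof. by move=> rx x0; split=> //; have [] := root_sign rx. Qed.

Lemma posroot_eq_sroot s x :
  posroot x -> (forall j, j != s -> x j 0 = 0) -> x = sroot s.
Proof.
move=> [rx x0] xs.
have xE : x = x s 0 *: sroot s.
  apply/matrixP => i j; rewrite ord1 mxE srootE; have [->|/xs ->] := eqVneq i s.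
    by rewrite mulr1.
  by rewrite mulr0.
have := form_root rx; rewrite {1 2}xE formZl formZr form_sroot cartan_diag => h.
suff x1 : x s 0 = 1 by rewrite xE x1 scale1r.
have : (x s 0 - 1) * (x s 0 + 1) = 0.
  by move: h; lra.
have := x0 s; move=> xs0 /eqP; rewrite mulf_eq0 => /orP[]/eqP; lra.
Qed.

(** Only the coordinate at [s] changes; if the image were negative, all the other coordinates would
    vanish. *)
Lemma posroot_refl s x : posroot x -> x <> sroot s -> posroot (refl s x).
Proof.
move=> px xs; have [rx x0] := px; apply: root_pos; first exact: root_refl.
move=> h; apply: xs; apply: posroot_eq_sroot => // j js; apply/le_anti.
by rewrite x0 andbT; have := h j; rewrite mxE refl_coord // oppr_ge0.
Qed.

(** Inversions on the left, the side for which inclusion is the right weak order ([weak_leP]). *)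
Definition inv w x : Prop := posroot x /\ nneg (- wact w^-1%g x).

Lemma invN w x : posroot x -> ~ inv w x -> posroot (wact w^-1%g x).
Proof.
by move=> px nx; apply: root_pos => [|h]; [apply: root_wact; case: px|apply: nx].
Qed.

Lemma inv1 x : ~ inv 1%g x.
Proof. by case=> px; rewrite invg1 wact1; apply: posroot_not_neg. Qed.

Definition ldes s w : bool := (len (S s * w)%g < len w)%N.

Lemma ldes_len s w : ldes s w -> len w = (len (S s * w)%g).+1.
Proof. by move=> h; apply/eqP; rewrite eqn_leq len_genM_ge. Qed.

(** If the lengths agreed, [wact_sroot_nneg] would apply to both [w] and [S s * w] and make one root
    both nonnegative and nonpositive. *)
Lemma ldesN_len s w : ~~ ldes s w -> len (S s * w)%g = (len w).+1.
Proof.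
rewrite -leqNgt leq_eqVlt => /orP[/eqP e|h]; last first.
  by apply/eqP; rewrite eqn_leq len_genM.
have := @wact_sroot_nneg s w; rewrite e leqnn => /(_ isT) h1.
have := @wact_sroot_nneg s (S s * w)%g.
rewrite gen_mulKg e leqnn invMg gen_invg wactM wact_gen refl_sroot wactN.
move=> /(_ isT) h2; case: (root_neq0 (root_wact w^-1%g (root_sroot s))).
exact: nneg_anti h1 h2.
Qed.

Lemma ldes_gen s w : ldes s (S s * w)%g = ~~ ldes s w.
Proof.
case: (boolP (ldes s w)) => h; rewrite /ldes gen_mulKg.
  by rewrite (ldes_len h) ltnNge leqnSn.
by rewrite ldesN_len // ltnS leqnn.
Qed.

Lemma ldesP s w : reflect (inv w (sroot s)) (ldes s w).
Proof.
apply: (iffP idP) => [h|[_]].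
  split; first exact: posroot_sroot.
  have := @wact_sroot_nneg s (S s * w)%g; rewrite gen_mulKg.
  rewrite invMg gen_invg wactM wact_gen refl_sroot wactN; apply; exact: ltnW.
apply: contraPT; rewrite -leqNgt => /wact_sroot_nneg h1.
apply: posroot_not_neg; split=> //; apply: root_wact; exact: root_sroot.
Qed.

Lemma ldes_ex w : w <> 1%g -> exists s, ldes s w.
Proof.
move=> w1; suff [s sw] : exists s, (len (S s * w)%g).+1 = len w.
  by exists s; rewrite /ldes -sw.
exact: left_descent.
Qed.

Lemma inv_refl s w x : posroot x -> x <> sroot s ->
  inv w x <-> inv (S s * w)%g (refl s x).
Proof.
move=> px xs; rewrite /inv invMg gen_invg wactM wact_gen reflK.
by have := posroot_refl px xs; tauto.
Qed.

Lemma inv_refl' s w x : posroot x -> x <> sroot s ->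
  inv (S s * w)%g x <-> inv w (refl s x).
Proof. by move=> px xs; rewrite -{2}[w](gen_mulKg s); apply: inv_refl. Qed.

Lemma weak_lenP u w :
  reflect (len w = (len u + len (u^-1 * w)%g)%N :> nat) (weak_le S u w).
Proof. exact: eqP. Qed.

(** Induction on the length of [u]: a left descent of [u] is one of [w], and dividing both by it
    removes a simple root and reflects all other inversions. *)
Lemma weak_leP u w : weak_le S u w <-> (forall x, inv u x -> inv w x).
Proof.
elim/ltn_ind: (len u) {-2}u (erefl (len u)) w => l IH {}u ul w.
have [->|/ldes_ex[s su]] := pselect (u = 1%g).
  by split=> [_ x /inv1//|_]; rewrite /weak_le cox_length1 invg1 mul1g.
have lu := ldes_len su; have lt : (len (S s * u)%g < l)%N by rewrite -ul.
have {}IH := IH _ lt _ erefl; have usu : u = (S s * (S s * u))%g by rewrite gen_mulKg.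
have gE : (u^-1 * w = (S s * u)^-1 * (S s * w))%g.
  by rewrite invMg -mulgA mulKg.
split=> [/eqP uw|uw].
  have sw : ldes s w /\ weak_le S (S s * u)%g (S s * w)%g.
    have le1 : (len (S s * w)%g <= len (S s * u)%g + len (u^-1 * w)%g)%N.
      by rewrite gE -{1}(mulKVg (S s * u) (S s * w))%g cox_lengthM.
    have ge1 := len_genM_ge s w.
    by rewrite /ldes /weak_le -gE; split; move: uw lu le1 ge1; lia.
  case: sw => sw /IH sub x xu; have [->|xs] := pselect (x = sroot s).
    exact/ldesP.
  have px := xu.1; apply/(inv_refl _ px xs); apply: sub.
  exact/(inv_refl _ px xs).
have sw : ldes s w by apply/ldesP/uw/ldesP.
have /IH/eqP : forall x, inv (S s * u)%g x -> inv (S s * w)%g x.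
  move=> x xu; have px := xu.1; have [xs|xs] := pselect (x = sroot s).
    by move: xu; rewrite xs => /ldesP; rewrite ldes_gen su.
  by apply/(inv_refl' _ px xs)/uw/(inv_refl' _ px xs).
by rewrite -gE => e; rewrite /weak_le (ldes_len sw) lu e.
Qed.

Lemma weak_le_len u w : weak_le S u w -> (len u <= len w)%N.
Proof. by move/eqP->; rewrite leq_addr. Qed.

Lemma weak_le_eq u w : weak_le S u w -> (len w <= len u)%N -> u = w.
Proof.
move=> /eqP uw; rewrite uw -{2}[len u]addn0 leq_add2l leqn0 => /eqP.
by move=> /cox_length_eq0/mulg1_eq; rewrite invgK.
Qed.

Lemma weak_le1 w : weak_le S 1%g w.
Proof. by apply/weak_leP => x /inv1. Qed.

Lemma weak_le_gen s w : ldes s w -> weak_le S (S s) w.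
Proof.
move=> sw; apply/weak_leP => x xs; have [->|nxs] := pselect (x = sroot s).
  exact/ldesP.
have px := xs.1; case: (@inv1 (refl s x)); apply/(inv_refl' 1%g px nxs).
by rewrite mulg1.
Qed.

Lemma ldes_le s u w : weak_le S u w -> ldes s u -> ldes s w.
Proof. by move=> /weak_leP uw /ldesP/uw/ldesP. Qed.

Lemma weak_le_mull s u w : ldes s u -> ldes s w ->
  weak_le S (S s * u)%g (S s * w)%g <-> weak_le S u w.
Proof.
move=> su sw; rewrite /weak_le (ldes_len su) (ldes_len sw) invMg -mulgA mulKg.
by rewrite addSn eqSS.
Qed.

(** A nontrivial element has a left descent, whose simple root is made negative by its inverse. *)
Lemma wact_faithful u v : (forall x, wact u x = wact v x) -> u = v.
Proof.
move=> uv; suff /mulg1_eq : (u^-1 * v = 1)%g by rewrite invgK.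
have [//|/ldes_ex[s /ldesP[_]]] := pselect (u^-1 * v = 1)%g.
rewrite invMg invgK wactM uv -wactM mulVg wact1.
by move/(posroot_not_neg (posroot_sroot s)).
Qed.

Lemma wact_conj w r s : wact w (sroot r) = sroot s -> (w * S r = S s * w)%g.
Proof.
move=> ws; apply: wact_faithful => x; rewrite !wactM !wact_gen /refl -ws.
by rewrite wactD wactN wactZ form_wact.
Qed.

Definition rdes r w : bool := (len (w * S r)%g < len w)%N.

Lemma rdesE r w : rdes r w = ldes r w^-1%g.
Proof. by rewrite /rdes /ldes lenV -lenV invMg gen_invg. Qed.

Lemma rdes_neg r w : rdes r w -> posroot (- wact w (sroot r)).
Proof.
rewrite rdesE => /ldesP[_]; rewrite invgK; split=> //.
by apply: root_opp; apply: root_wact; apply: root_sroot.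
Qed.

Lemma rdesN_pos r w : ~~ rdes r w -> posroot (wact w (sroot r)).
Proof.
rewrite rdesE => /ldesP h; rewrite -[w]invgK; apply: invN => //.
exact: posroot_sroot.
Qed.

Lemma rdes_gen r w : rdes r (w * S r)%g = ~~ rdes r w.
Proof. by rewrite !rdesE invMg gen_invg ldes_gen. Qed.

Lemma rdes_len r w : rdes r w -> len w = (len (w * S r)%g).+1.
Proof.
by rewrite rdesE => /ldes_len; rewrite lenV -{1}[S r]gen_invg -invMg lenV.
Qed.

(** * Joins and parabolic parts *)

Notation le := (weak_le S).

Lemma inv_mulr r w x : ~~ rdes r w ->
  inv (w * S r)%g x <-> inv w x \/ x = wact w (sroot r).
Proof.
move=> rw; have pr := rdesN_pos rw.
rewrite /inv invMg gen_invg wactM wact_gen; split=> [[px h]|].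
  have [hw|hw] := pselect (nneg (- wact w^-1%g x)); first by left.
  have py : posroot (wact w^-1%g x) by apply: invN => // -[].
  have [e|ne] := pselect (wact w^-1%g x = sroot r).
    by right; rewrite -e wactVK.
  by case: (posroot_not_neg (posroot_refl py ne)).
case=> [[px h]|->].
  split=> //; rewrite -wact_gen -wactN wact_gen.
  have py : posroot (- wact w^-1%g x).
    by split=> //; apply: root_opp; apply: root_wact; case: px.
  suff /(posroot_refl py)[] : - wact w^-1%g x <> sroot r by [].
  move=> /(congr1 (wact w)); rewrite wactN wactVK => e.
  by apply: (posroot_not_neg pr); rewrite -e opprK; case: px.
by split=> //; rewrite wactK refl_sroot opprK; apply: nneg_sroot.
Qed.

Lemma rdesN_len r w : ~~ rdes r w -> len (w * S r)%g = (len w).+1.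
Proof.
by rewrite rdesE => /ldesN_len; rewrite -[S r in LHS]gen_invg -invMg !lenV.
Qed.

Lemma weak_le_mulr r w : ~~ rdes r w -> le w (w * S r)%g.
Proof. by move=> rw; apply/weak_leP => x xw; apply/(inv_mulr _ rw); left. Qed.

Lemma weak_cover_up u w : le u w -> u <> w ->
  exists r, ~~ rdes r u /\ le (u * S r)%g w.
Proof.
pose g : W := (u^-1 * w)%g; move=> /weak_lenP; rewrite -/g => uw nuw.
have [|r rg] := @ldes_ex g; first by move=> /mulg1_eq; rewrite invgK.
have lg := ldes_len rg; have gE : ((u * S r)^-1 * w = S r * g)%g.
  by rewrite invMg gen_invg mulgA.
have le1 : (len w <= len (u * S r)%g + len (S r * g)%g)%N.
  by rewrite -gE -{1}(mulKVg (u * S r) w)%g cox_lengthM.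
have le2 : (len (u * S r)%g <= (len u).+1)%N.
  by rewrite -lenV invMg gen_invg -[len u]lenV len_genM.
exists r; rewrite /rdes -leqNgt.
by split; [|apply/weak_lenP; rewrite gE]; lia.
Qed.

Lemma weak_cover_down u w : le u w -> u <> w ->
  exists r, rdes r w /\ le u (w * S r)%g.
Proof.
pose g : W := (u^-1 * w)%g; move=> /weak_lenP; rewrite -/g => uw nuw.
have [|r rg] := @ldes_ex g^-1%g.
  by move=> /eqP; rewrite invg_eq1 => /eqP/mulg1_eq; rewrite invgK.
rewrite -rdesE in rg; have lg := rdes_len rg.
have gE : (u^-1 * (w * S r) = g * S r)%g by rewrite mulgA.
have le1 : (len (w * S r)%g <= len u + len (g * S r)%g)%N.
  by rewrite -gE -{1}(mulKVg u (w * S r))%g cox_lengthM.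
have le2 : (len w <= (len (w * S r)%g).+1)%N.
  rewrite -[len w]lenV -[len (w * _)%g]lenV invMg gen_invg; exact: len_genM_ge.
exists r; rewrite /rdes.
by split; [|apply/weak_lenP; rewrite gE]; lia.
Qed.

Lemma weak_le_additive (x a m : W) : le x m -> le a (x^-1 * m)%g -> le x (x * a)%g.
Proof.
move=> /eqP xm /eqP am; rewrite /weak_le mulKg eqn_leq cox_lengthM.
have : (len m <= len (x * a)%g + len (a^-1 * (x^-1 * m))%g)%N.
  have <- : ((x * a)^-1 * m = a^-1 * (x^-1 * m))%g by rewrite invMg mulgA.
  by rewrite -{1}(mulKVg (x * a) m)%g cox_lengthM.
by rewrite xm am addnA leq_add2r.
Qed.

(** Translation by [x] reduces joins of covers of [x] to joins of two generators. *)
Lemma weak_le_mulL (x a z : W) : le x (x * a)%g -> le x z ->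
  le (x * a)%g z = le a (x^-1 * z)%g.
Proof.
rewrite /weak_le mulKg => /eqP -> /eqP ->.
by rewrite invMg mulgA -addnA eqn_add2l.
Qed.

Definition is_join (p q j : W) : Prop :=
  [/\ le p j, le q j & forall z : W, le p z -> le q z -> le j z].

Lemma wact_alt_coord s t k x j : j != s -> j != t ->
  wact (alt s t k) x j 0 = x j 0.
Proof.
elim: k s t => [|k IH] s t js jt; first by rewrite wact1.
by rewrite altS wactM wact_gen refl_coord // IH.
Qed.

Lemma wact_altV_coord s t k x j : j != s -> j != t ->
  wact (alt s t k)^-1%g x j 0 = x j 0.
Proof. by move=> js jt; rewrite altV; case: ifP => _; rewrite wact_alt_coord. Qed.

Lemma vec2E s t x : s != t -> (forall j, j != s -> j != t -> x j 0 = 0) ->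
  x = x s 0 *: sroot s + x t 0 *: sroot t.
Proof.
move=> st x0; apply/matrixP => j k; rewrite ord1 !mxE eqxx !andbT.
have [->|js] := eqVneq j s; first by rewrite (negPf st) mulr1 mulr0 addr0.
have [->|jt] := eqVneq j t; first by rewrite mulr0 mulr1 add0r.
by rewrite !mulr0 addr0 x0.
Qed.

Lemma inv_dihedral s t w x : s != t -> ldes s w -> ldes t w -> posroot x ->
  (forall j, j != s -> j != t -> x j 0 = 0) -> inv w x.
Proof.
move=> st /ldesP[_ sw] /ldesP[_ tw] px /(vec2E st) xE; split=> //.
rewrite xE wactD !wactZ opprD -!scalerN.
by apply: nnegD; apply: nnegZ => //; case: px => _; apply.
Qed.

Lemma len_gen1 r : len (S r) = 1%N.
Proof.
apply/eqP; rewrite eqn_leq len_gen lt0n; apply/eqP => /cox_length_eq0.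
exact: gen_neq1.
Qed.

Lemma weak_le_genE r w : le (S r) w = ldes r w.
Proof.
apply/idP/idP => [rw|]; last exact: weak_le_gen.
by apply: (ldes_le rw); rewrite /ldes gen_mulgg cox_length1 len_gen1.
Qed.

(* The alternating element is the longest one of a finite dihedral subgroup. *)
Lemma dihedral_join s t w : s != t -> ldes s w -> ldes t w ->
  exists k, [/\ len (alt t s k) = k, ldes s (alt t s k) &
    is_join (S s) (S t) (alt t s k)].
Proof.
move=> st sw tw; pose P k := (len (alt t s k) == k) && le (alt t s k) w.
have P1 : P 1%N.
  by rewrite /P altS mulg1 len_gen1 eqxx weak_le_genE.
have Pmax k : P k -> (k <= len w)%N by case/andP => /eqP e /weak_le_len; rewrite e.
have [] := ex_maxnP (ex_intro _ 1%N P1) Pmax.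
case=> [|k] Pk maxk; first by have := maxk _ P1.
case/andP: Pk => /eqP lk kw; exists k.+1; set p := alt t s k.+1 in lk kw *.
have supp x : inv p x -> forall j, j != s -> j != t -> x j 0 = 0.
  move=> [[_ x0] px] j js jt; apply/le_anti; rewrite x0 andbT.
  by have := px j; rewrite mxE wact_altV_coord // oppr_ge0.
have le_p (z : W) : ldes s z -> ldes t z -> le p z.
  move=> sz tz; apply/weak_leP => x px; apply: (inv_dihedral st) => //.
    by case: px.
  exact: supp.
have rd1 : rdes (if odd k.+1 then s else t) p.
  set q := if _ then _ else _; apply: contraT => qp.
  suff /maxk : P k.+2 by rewrite ltnn.
  have pS : alt t s k.+2 = (p * S q)%g by rewrite altSr.
  rewrite /P pS rdesN_len // lk eqxx; apply/weak_leP => x.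
  move=> /(inv_mulr _ qp)[|->]; first by move/weak_leP: kw; apply.
  apply: (inv_dihedral st) => // [|j js jt]; first exact: rdesN_pos.
  rewrite wact_alt_coord // srootE /q; case: ifP => _; first by rewrite (negPf js).
  by rewrite (negPf jt).
have rd2 : rdes (if odd k then s else t) p.
  rewrite /rdes lk /p altSr -mulgA gen_mulgg mulg1 ltnS; exact: alt_len.
have rd r : r = s \/ r = t -> nneg (- wact p (sroot r)).
  have h q : rdes q p -> nneg (- wact p (sroot q)) by case/rdes_neg.
  by case=> ->; move: (h _ rd1) (h _ rd2) => /=; case: (odd k).
(* Were the root of [r] no inversion of [p], its preimage would be a nonnegative combination of the
   two simple roots, both of which [p] makes negative. *)
have ld r : r = s \/ r = t -> ldes r p.
  move=> rst; apply/ldesP; have [//|npr] := pselect (inv p (sroot r)).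
  have [_ d0] := invN (posroot_sroot r) npr.
  set d := wact p^-1%g (sroot r) in d0.
  have supd j : j != s -> j != t -> d j 0 = 0.
    move=> js jt; rewrite wact_altV_coord // srootE.
    by case: rst => ->; rewrite ?(negPf js) ?(negPf jt).
  have rE : sroot r = d s 0 *: wact p (sroot s) + d t 0 *: wact p (sroot t).
    by rewrite -!wactZ -wactD -(vec2E st supd) wactVK.
  case: (posroot_not_neg (posroot_sroot r)); rewrite rE opprD -!scalerN.
  by apply: nnegD; apply: nnegZ => //; apply: rd; tauto.
split=> //; first by apply: ld; left.
split=> [||z]; rewrite !weak_le_genE.
- by apply: ld; left.
- by apply: ld; right.
exact: le_p.
Qed.

Lemma join_covers (x : W) r q m : r != q -> ~~ rdes r x -> ~~ rdes q x ->
  le (x * S r)%g m -> le (x * S q)%g m ->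
  exists j : W, is_join (x * S r)%g (x * S q)%g j.
Proof.
move=> rq rx qx rm qm.
have xr := weak_le_mulr rx; have xq := weak_le_mulr qx.
have xm : le x m := weak_le_trans xr rm.
have rg : ldes r (x^-1 * m)%g by rewrite -weak_le_genE -weak_le_mulL.
have qg : ldes q (x^-1 * m)%g by rewrite -weak_le_genE -weak_le_mulL.
have [k [_ _ [rp qp lub]]] := dihedral_join rq rg qg.
set p := alt q r k in rp qp lub; exists (x * p)%g.
have pm : le p (x^-1 * m)%g by apply: lub; rewrite weak_le_genE.
have xp : le x (x * p)%g := weak_le_additive xm pm.
split=> [||z rz qz].
- by rewrite weak_le_mulL // mulKg.
- by rewrite weak_le_mulL // mulKg.
have xz := weak_le_trans xr rz.
by rewrite weak_le_mulL //; apply: lub; rewrite -weak_le_mulL.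
Qed.

(** From local joins to all joins, by induction on the distance from a common lower bound [x] to
    [m]. Join two covers of [x] below [p] and [q] to [j1], then [p] with [j1] and [q] with [j1],
    then the two results; each of these joins has a lower bound above [x]. *)
Lemma join_exists (p q m : W) : le p m -> le q m -> exists j : W, is_join p q j.
Proof.
suff h d (x : W) : (len m - len x <= d)%N -> forall p q : W, le x p -> le x q ->
    le p m -> le q m -> exists j : W, is_join p q j.
  exact: (h _ 1%g (leqnn _) p q (weak_le1 p) (weak_le1 q)).
elim: d x => [|d IH] x dx {}p {}q xp xq pm qm.
  have xm (y : W) : le x y -> le y m -> y = m.
    move=> xy ym; apply: (weak_le_eq ym).
    by apply: leq_trans _ (weak_le_len xy); rewrite -subn_eq0 -leqn0.
  rewrite (xm _ xp pm) (xm _ xq qm); exists m; split=> //; exact: weak_le_refl.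
have [<-|nxp] := pselect (x = p).
  by exists q; split=> //; apply: weak_le_refl.
have [<-|nxq] := pselect (x = q).
  by exists p; split=> //; apply: weak_le_refl.
have [r [rx rp]] := weak_cover_up xp nxp.
have [t [tx tq]] := weak_cover_up xq nxq.
have IHr a : ~~ rdes a x -> forall p q : W, le (x * S a)%g p -> le (x * S a)%g q ->
    le p m -> le q m -> exists j : W, is_join p q j.
  by move=> ax; apply: IH; rewrite rdesN_len // subnS; move: dx; lia.
have [rt|rt] := eqVneq r t; first by apply: (IHr _ rx) => //; rewrite rt.
have [||j1 [rj tj lub1]] := @join_covers x r t m rt rx tx.
  - exact: weak_le_trans rp pm.
  - exact: weak_le_trans tq qm.
have j1m : le j1 m.
  by apply: lub1; [apply: weak_le_trans rp pm|apply: weak_le_trans tq qm].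
have [j2 [pj2 jj2 lub2]] := IHr _ rx _ _ rp rj pm j1m.
have [j3 [qj3 jj3 lub3]] := IHr _ tx _ _ tq tj qm j1m.
have j2m := lub2 _ pm j1m; have j3m := lub3 _ qm j1m.
have [j4 [j24 j34 lub4]] :=
  IHr _ rx _ _ (weak_le_trans rj jj2) (weak_le_trans rj jj3) j2m j3m.
exists j4; split.
- exact: weak_le_trans pj2 j24.
- exact: weak_le_trans qj3 j34.
move=> z pz qz; have j1z : le j1 z.
  by apply: lub1; [apply: weak_le_trans rp pz|apply: weak_le_trans tq qz].
by apply: lub4; [apply: lub2|apply: lub3].
Qed.

(* [par s w]: [w] belongs to the standard parabolic subgroup generated by all
   the generators except [s]. *)
Definition par s w : Prop := forall x, inv w x -> x s 0 = 0.

Lemma par_le s u w : le u w -> par s w -> par s u.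
Proof. by move=> /weak_leP uw pw x /uw/pw. Qed.

Lemma par1 s : par s 1%g. Proof. by move=> x /inv1. Qed.

Lemma par_ldesN s w : par s w -> ~~ ldes s w.
Proof.
move=> pw; apply/ldesP => /pw /eqP; by rewrite srootE eqxx oner_eq0.
Qed.

Lemma par_mull s r w : ldes r w -> par s w -> par s (S r * w)%g.
Proof.
move=> rw pw x xw; have px := xw.1.
have xr : x <> sroot r.
  by move=> xr; move: xw; rewrite xr => /ldesP; rewrite ldes_gen rw.
have rs : s != r by apply: contraTneq rw => <-; apply: par_ldesN.
have <- : refl r x s 0 = x s 0 by rewrite refl_coord.
apply: pw.
exact/(inv_refl' _ px xr).
Qed.

Lemma parP s w : par s w <-> forall x, wact w x s 0 = x s 0.
Proof.
split=> [|pw x [[_ x0] xw]]; last first.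
  apply/le_anti; rewrite x0 andbT; have := xw s; rewrite mxE oppr_ge0.
  by have := pw (wact w^-1%g x); rewrite wactVK => ->.
elim/ltn_ind: (len w) {-2}w (erefl (len w)) => l IH {}w lw pw x.
have [->|/ldes_ex[r rw]] := pselect (w = 1%g); first by rewrite wact1.
have rs : s != r by apply: contraTneq rw => <-; apply: par_ldesN.
rewrite -(gen_mulKg r w) wactM wact_gen refl_coord //.
by apply: (IH _ _ _ erefl) => //; [rewrite -lw|apply: par_mull].
Qed.

(** Strip left descents other than [s]. When none is left, the inverse of [w] keeps every other
    simple root nonnegative, so each inversion involves [s] and the part is 1. *)
Lemma par_part s w : exists u, [/\ par s u, le u w &
  forall x, inv u x <-> inv w x /\ x s 0 = 0].
Proof.
suff [u uE] : exists u, forall x, inv u x <-> inv w x /\ x s 0 = 0.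
  by exists u; split=> // [x /uE[]//|]; apply/weak_leP => x /uE[].
elim/ltn_ind: (len w) {-2}w (erefl (len w)) => l IH {}w lw.
have [[r [rs rw]]|none] := pselect (exists r, s != r /\ ldes r w).
  have lt : (len (S r * w)%g < l)%N by rewrite -lw.
  have [u uE] := IH _ lt _ erefl.
  exists (S r * u)%g => x; have [->|xr] := pselect (x = sroot r).
    rewrite srootE (negPf rs); split=> [_|_].
      by split=> //; apply/ldesP.
    apply/ldesP; rewrite ldes_gen; apply/ldesP => /uE[/ldesP].
    by rewrite ldes_gen rw.
  have [px|npx] := pselect (posroot x); last by split=> [[]|[[]]].
  rewrite (inv_refl' _ px xr) uE -(inv_refl _ px xr).
  by rewrite refl_coord.
exists 1%g => x; split=> [/inv1//|[[px xw] xs]].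
have rx : root (wact w^-1%g x) by apply: root_wact; case: px.
exfalso; apply: (root_neq0 rx); apply: nneg_anti => //.
rewrite (vecE x) wact_sum; apply: nneg_sum => j; rewrite wactZ.
have [->|js] := eqVneq j s; first by rewrite xs scale0r => i; rewrite mxE.
apply: nnegZ; first by case: px.
apply: wact_sroot_nneg; rewrite leqNgt; apply/negP => jw; apply: none.
by exists j; rewrite eq_sym.
Qed.

(** Climb from [v] towards [z] along covers. The first step that gains the descent [s] is above both
    [s] and [v], so it ends at [z], and the inversion it adds is the simple root of [s]. *)
Lemma join_gen_cover s v (z : W) : is_join (S s) v z -> par s v ->
  [/\ ldes s z, le v (S s * z)%g & exists r,
      [/\ ~~ rdes r (S s * z)%g, (S s * z * S r = z)%g &
          wact (S s * z)%g (sroot r) = sroot s]].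
Proof.
move=> [sz vz lub] pv; rewrite weak_le_genE in sz.
suff [u [vu [r [ru uz we]]]] : exists u, le v u /\ exists r,
    [/\ ~~ rdes r u, (u * S r = z)%g & wact u (sroot r) = sroot s].
  have -> : (S s * z = u)%g by rewrite -uz (wact_conj we) gen_mulKg.
  by split=> //; exists r.
suff main d u : (len z - len u <= d)%N -> le v u -> le u z -> ~~ ldes s u ->
    exists u', le v u' /\ exists r,
      [/\ ~~ rdes r u', (u' * S r = z)%g & wact u' (sroot r) = sroot s].
  exact: (main _ v (leqnn _) (weak_le_refl S v) vz (par_ldesN pv)).
elim: d u => [|d IH] u du vu uz su.
  case/negP: su; rewrite (weak_le_eq uz) //.
  by rewrite -subn_eq0 -leqn0.
have [r [ru rz]] : exists r, ~~ rdes r u /\ le (u * S r)%g z.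
  by apply: weak_cover_up => // uE; rewrite uE sz in su.
have [sr|sr] := boolP (ldes s (u * S r)%g); last first.
  apply: (IH (u * S r)%g) => //; last exact: weak_le_trans vu (weak_le_mulr ru).
  by rewrite rdesN_len // subnS; move: du; case: (_ - _)%N.
exists u; split=> //; exists r; split=> //.
  apply: (@weak_le_anti W n S); rewrite rz lub ?weak_le_genE //.
  exact: weak_le_trans vu (weak_le_mulr ru).
by move/ldesP: sr => /(inv_mulr _ ru)[/ldesP|//]; rewrite (negPf su).
Qed.

Lemma form_sroot_le0 s x : nneg x -> x s 0 = 0 -> form (sroot s) x <= 0.
Proof.
move=> x0 xs; rewrite formC form_srootr sumr_le0 // => j _.
have [->|js] := eqVneq j s; first by rewrite xs mul0r.
by apply: mulr_ge0_le0; [apply: x0|apply: cartan_le0].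
Qed.

(* Otherwise the part [V] of [z] in the parabolic subgroup would cover some
   [V2 = V r >= v]; with [t = V r V^-1], the shorter element [t z = V2 g], where
   [z = V g], would still be an upper bound of [s] and [v], since the simple root
   of [s] pairs nonpositively with the root of [t]. *)
Lemma join_gen_par s v (z : W) u : is_join (S s) v z -> par s v ->
  par s u -> le u z -> le u v.
Proof.
move=> [sz vz lub] pv pu uz; rewrite weak_le_genE in sz.
have [V [pV Vz VE]] := par_part s z.
have le_V (y : W) : par s y -> le y z -> le y V.
  by move=> py /weak_leP yz; apply/weak_leP => x yx; apply/VE; split; auto.
have [->|nvV] := pselect (v = V); first exact: le_V.
have [r [rV vV]] := weak_cover_down (le_V _ pv vz) nvV.
have [rb b0] := rdes_neg rV; set b := - wact V (sroot r) in rb b0.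
have rs : s != r.
  apply/eqP => rs; have := b0 s; rewrite mxE (parP s V).1 // srootE rs eqxx.
  by rewrite oppr_ge0 ler10.
have bs : b s 0 = 0 by rewrite mxE (parP s V).1 // srootE (negPf rs) oppr0.
have inv_b : inv z b.
  suff /VE[] : inv V b by [].
  by split=> //; rewrite /b wactN wactK opprK; apply: nneg_sroot.
have [g zE] : exists g, z = (V * g)%g by exists (V^-1 * z)%g; rewrite mulVKg.
pose V2 : W := (V * S r)%g; pose z2 : W := (V2 * g)%g.
have V2V : le V2 V.
  have : le V2 (V2 * S r)%g by apply: weak_le_mulr; rewrite rdes_gen rV.
  by rewrite -mulgA gen_mulgg mulg1.
have g_pos d : posroot d -> d s 0 = 0 -> nneg (wact g^-1%g d).
  move=> pd ds; have ry : root (wact V d) by apply: root_wact; case: pd.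
  have ys : wact V d s 0 = 0 by rewrite (parP s V).1.
  have gE : wact g^-1%g d = wact z^-1%g (wact V d).
    by rewrite zE invMg wactM wactK.
  have [ny|/(root_pos ry) py] := pselect (nneg (- wact V d)).
    have : inv V (- wact V d).
      split; first by split=> //; apply: root_opp.
      by rewrite wactN wactK opprK; case: pd.
    by move=> /VE[[_]]; rewrite wactN opprK gE.
  rewrite gE; suff : ~ inv z (wact V d) by move=> /(invN py)[].
  move=> zy; have [_] : inv V (wact V d) by apply/VE; split.
  by rewrite wactK => /(posroot_not_neg pd).
have sz2 : ldes s z2.
  apply/ldesP; split; first exact: posroot_sroot.
  have -> : - wact z2^-1%g (sroot s)
      = - wact z^-1%g (sroot s) + (- form (sroot s) b) *: (- wact z^-1%g b).
    rewrite /z2 /V2 !invMg gen_invg !wactM wact_gen /refl wactD wactN wactZ.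
    have -> : form (wact V^-1%g (sroot s)) (sroot r) = - form (sroot s) b.
      by rewrite -(form_wact V) wactVK /b formNr opprK.
    rewrite zE invMg !wactM /b wactN wactK wactN opprK opprB addrC; congr (_ + _).
  have := sz; move=> /ldesP[_ nz]; apply: nnegD => //; apply: nnegZ.
    by rewrite oppr_ge0; apply: form_sroot_le0.
  by case: inv_b.
have V2z2 : le V2 z2.
  apply/weak_leP => x xV2; have [px nx] := xV2; split=> //.
  have pV2 : par s V2 := par_le V2V pV.
  have ds : (- wact V2^-1%g x) s 0 = 0.
    have := (parP s V2).1 pV2 (wact V2^-1%g x); rewrite wactVK => e.
    by rewrite mxE -e (pV2 _ xV2) oppr0.
  rewrite /z2 invMg wactM -wactN; apply: g_pos => //; split=> //.
  by apply: root_opp; apply: root_wact; case: px.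
have zz2 : le z z2.
  by apply: lub; [rewrite weak_le_genE|apply: weak_le_trans vV V2z2].
have lz := weak_le_len zz2; have lz2 : (len z2 <= len V2 + len g)%N.
  exact: cox_lengthM.
have lV := rdes_len rV; rewrite -/V2 in lV.
have lz1 : len z = (len V + len g)%N :> nat.
  by move/weak_lenP: Vz; rewrite {2}zE mulKg.
by move: (leq_trans lz lz2); rewrite lz1 lV addSn ltnn.
Qed.

(** * Sortable elements and projections *)

(* [L 0, L 1, ...] is the periodic repetition of the Coxeter element; the tail
   from [k] on belongs to a conjugate, so that induction on sorting words keeps
   [L] fixed and shifts [k]. *)
Section Sorting.
Variable L : nat -> 'I_n.
Hypothesis L_inj : forall k l, (k < l < k + n)%N -> L k <> L l.
Hypothesis L_surj : forall k i, exists2 d, (d < n)%N & L (k + d)%N = i.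

Fact pos_subproof k i : exists d, L (k + d)%N == i.
Proof. by have [d _ /eqP di] := L_surj k i; exists d. Qed.

(** The distance from [k] to the next letter [i]; comparing distances gives the order of the letters
    in the Coxeter element read off from [k]. *)
Definition pos k i : nat := ex_minn (pos_subproof k i).

Lemma posP k i : L (k + pos k i)%N = i.
Proof. by rewrite /pos; case: ex_minnP => d /eqP. Qed.

Lemma pos_min k i d : L (k + d)%N = i -> (pos k i <= d)%N.
Proof. by move/eqP; rewrite /pos; case: ex_minnP => m _; apply. Qed.

Lemma pos_lt k i : (pos k i < n)%N.
Proof.
by have [d dn di] := L_surj k i; apply: leq_ltn_trans (pos_min di) dn.
Qed.

Lemma pos0 k : pos k (L k) = 0%N.
Proof. by apply/eqP; rewrite -leqn0 pos_min // addn0. Qed.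

Lemma posS k i : i != L k -> pos k i = (pos k.+1 i).+1.
Proof.
move=> ik; apply/eqP; rewrite eqn_leq; apply/andP; split.
  by apply: pos_min; rewrite -addSnnS posP.
have := posP k i; case: (pos k i) => [|d].
  by rewrite addn0 => ki; rewrite ki eqxx in ik.
by rewrite -addSnnS ltnS; apply: pos_min.
Qed.

Lemma pos_last k i : i != L k -> (pos k.+1 i < pos k.+1 (L k))%N.
Proof.
move=> ik; have := pos_lt k i; rewrite (posS ik) => lt; rewrite ltnNge.
apply/negP => le1; case: (@L_inj k (k.+1 + pos k.+1 (L k))%N); last by rewrite posP.
by rewrite addSnnS -[X in (X < _)%N]addn0 !ltn_add2l /= (leq_ltn_trans _ lt).
Qed.

(* The skew-symmetric form of Reading and Speyer for the Coxeter element read off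
   from [k]; moving its first letter to the end amounts to a reflection. *)
Definition omc k i j : R :=
  if i == j then 0 else if (pos k i < pos k j)%N then - cartan i j else cartan i j.

Definition om k x y : R := \sum_i \sum_j x i 0 * omc k i j * y j 0.

(** The pairing of the skew form with the simple root of [s] when [s] is the first letter
    ([om_first]), and minus this pairing when it is the last ([om_last]). [om_off] is the part that
    ignores where [s] stands. *)
Definition om_lin s y : R := 2 * y s 0 - form (sroot s) y.
Definition om_off k s x y : R :=
  \sum_(i | i != s) \sum_(j | j != s) x i 0 * omc k i j * y j 0.

Lemma om_linE s y : om_lin s y = - \sum_(j | j != s) cartan s j * y j 0.
Proof.
rewrite /om_lin formC form_srootr (bigD1 s) //= cartan_diag.
rewrite [y s 0 * 2]mulrC opprD addNKr; congr (- _).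
by apply: eq_bigr => j _; rewrite mulrC cartanC.
Qed.

Lemma sum_split s (f : 'I_n -> 'I_n -> R) :
  \sum_i \sum_j f i j = \sum_(i | i != s) \sum_(j | j != s) f i j
   + (f s s + \sum_(j | j != s) f s j + \sum_(i | i != s) f i s).
Proof.
rewrite (bigD1 s) //= (bigD1 s (F := fun j => f s j)) //= [RHS]addrC -!addrA.
congr (_ + (_ + _)); rewrite -big_split; apply: eq_bigr => i _.
by rewrite (bigD1 s) //=.
Qed.

Lemma om_split k x y (s := L k) :
  om k x y = om_off k s x y + (x s 0 * om_lin s y - y s 0 * om_lin s x).
Proof.
rewrite /om (sum_split s) /om_off; congr (_ + _).
rewrite /omc eqxx mulr0 mul0r add0r !om_linE !mulrN opprK; congr (_ + _).
  rewrite mulr_sumr -sumrN; apply: eq_bigr => j js.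
  by rewrite eq_sym (negPf js) pos0 (posS js) /= mulrN mulNr mulrA.
rewrite mulr_sumr; apply: eq_bigr => j js.
by rewrite (negPf js) pos0 ltn0 cartanC; ring.
Qed.

Lemma omS_split k x y (s := L k) :
  om k.+1 x y = om_off k s x y - (x s 0 * om_lin s y - y s 0 * om_lin s x).
Proof.
rewrite /om (sum_split s) /om_off; congr (_ + _).
  apply: eq_bigr => i ik; apply: eq_bigr => j jk; rewrite /omc.
  by rewrite (posS ik) (posS jk) ltnS.
rewrite /omc eqxx mulr0 mul0r add0r !om_linE !mulrN opprK opprD opprK; congr (_ + _).
  rewrite mulr_sumr; apply: eq_bigr => j js.
  by rewrite eq_sym (negPf js) ltnNge ltnW ?pos_last // mulrA.
rewrite mulr_sumr -sumrN; apply: eq_bigr => j js.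
by rewrite (negPf js) pos_last // cartanC; ring.
Qed.

Lemma refl_coord_eq s x : refl s x s 0 = x s 0 - form x (sroot s).
Proof. by rewrite !mxE eqxx mulr1. Qed.

Lemma om_lin_refl s x : om_lin s (refl s x) = om_lin s x.
Proof.
rewrite /om_lin; have -> : form (sroot s) (refl s x) = - form (sroot s) x.
  by rewrite -{1}[sroot s](reflK s) form_refl refl_sroot formNl.
by rewrite refl_coord_eq [form x _]formC; ring.
Qed.

(** The reflection fixes [om_lin] and replaces the coordinate at [L k] by [om_lin] minus it. This
    negates the part involving [L k], as does moving that letter to the end. *)
Lemma om_refl k x y : om k.+1 (refl (L k) x) (refl (L k) y) = om k x y.
Proof.
rewrite omS_split om_split !om_lin_refl.
have -> : om_off k (L k) (refl (L k) x) (refl (L k) y) = om_off k (L k) x y.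
  apply: eq_bigr => i ik; apply: eq_bigr => j jk.
  by rewrite !refl_coord.
have h z : refl (L k) z (L k) 0 = om_lin (L k) z - z (L k) 0.
  by rewrite refl_coord_eq /om_lin [form z _]formC; ring.
by rewrite !h; ring.
Qed.

Lemma om_par k x y : x (L k) 0 = 0 -> y (L k) 0 = 0 -> om k.+1 x y = om k x y.
Proof. by move=> x0 y0; rewrite omS_split om_split x0 y0 !mul0r subr0 oppr0. Qed.

Lemma om_off0 k s y : om_off k s (sroot s) y = 0.
Proof.
rewrite /om_off big1 // => i /negPf si; rewrite big1 // => j _.
by rewrite srootE si !mul0r.
Qed.

Lemma om_lin0 s : om_lin s (sroot s) = 0.
Proof. by rewrite /om_lin form_sroot cartan_diag srootE eqxx mulr1 subrr. Qed.

Lemma om_first k y : om k (sroot (L k)) y = om_lin (L k) y.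
Proof. by rewrite om_split om_off0 om_lin0 srootE eqxx mulr0 subr0 mul1r add0r. Qed.

Lemma om_last k y : om k.+1 (sroot (L k)) y = - om_lin (L k) y.
Proof. by rewrite omS_split om_off0 om_lin0 srootE eqxx mulr0 subr0 mul1r add0r. Qed.

Lemma om_lin_ge0 s y : nneg y -> 0 <= om_lin s y.
Proof.
move=> y0; rewrite om_linE oppr_ge0 sumr_le0 // => j js.
by apply: mulr_le0_ge0 => //; apply: cartan_le0; rewrite eq_sym.
Qed.

(** If [om_lin] vanishes, the reflection negates the coordinate at [s]; both signs are nonnegative,
    so this coordinate is 0. *)
Lemma om_lin_eq0 s y : posroot y -> y <> sroot s -> om_lin s y = 0 ->
  form (sroot s) y = 0.
Proof.
move=> py ys y0; have [_ /(_ s)] := posroot_refl py ys.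
have -> : refl s y s 0 = om_lin s y - y s 0.
  by rewrite refl_coord_eq /om_lin [form y _]formC; ring.
have := py.2 s; move: y0; rewrite /om_lin; lra.
Qed.

Lemma om_first_ge0 k y : nneg y -> 0 <= om k (sroot (L k)) y.
Proof. by rewrite om_first; apply: om_lin_ge0. Qed.

Lemma om_last_le0 k y : nneg y -> om k.+1 (sroot (L k)) y <= 0.
Proof. by rewrite om_last oppr_le0; apply: om_lin_ge0. Qed.

Lemma om_first_eq0 k y : posroot y -> y <> sroot (L k) ->
  om k (sroot (L k)) y = 0 -> form (sroot (L k)) y = 0.
Proof. by rewrite om_first; apply: om_lin_eq0. Qed.

(* Reading and Speyer's recursive description of sortable elements. *)
Inductive sortk : nat -> W -> Prop :=
| sort_one k : sortk k 1%g
| sort_desc k w : ldes (L k) w -> sortk k.+1 (S (L k) * w)%g -> sortk k w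
| sort_skip k w : par (L k) w -> sortk k.+1 w -> sortk k w.

Lemma ldes1 s : ldes s 1%g = false.
Proof. by rewrite /ldes cox_length1. Qed.

Lemma sortk_desc k w : sortk k w -> ldes (L k) w ->
  sortk k.+1 (S (L k) * w)%g.
Proof.
case=> {k w} [k|k w //|k w /par_ldesN]; first by rewrite ldes1.
by move=> /negPf->.
Qed.

Lemma sortk_skip k w : sortk k w -> ~~ ldes (L k) w ->
  par (L k) w /\ sortk k.+1 w.
Proof.
case=> {k w} [k _|k w ->//|k w //].
by split; [apply: par1|apply: sort_one].
Qed.

Definition is_part s w u : Prop := forall x, inv u x <-> inv w x /\ x s 0 = 0.

Lemma is_part_le s w u : is_part s w u -> le u w.
Proof. by move=> uE; apply/weak_leP => x /uE[]. Qed.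

Lemma is_part_par s w u : is_part s w u -> par s u.
Proof. by move=> uE x /uE[]. Qed.

Lemma is_part_max s w u v : is_part s w u -> par s v -> le v w -> le v u.
Proof.
move=> uE pv /weak_leP vw; apply/weak_leP => x vx; apply/uE; split.
  exact: vw.
exact: pv.
Qed.

Lemma nneg_wactV w x : posroot x -> nneg (wact w^-1%g x) <-> ~ inv w x.
Proof.
move=> px; split=> [h [_]|/(invN px)[]//].
by apply: (@posroot_not_neg (wact w^-1%g x)); split=> //; apply: root_wact px.1.
Qed.

Lemma is_part_nneg s w u x : is_part s w u -> root x -> x s 0 = 0 ->
  nneg (wact u^-1%g x) <-> nneg (wact w^-1%g x).
Proof.
move=> uE rx xs; have [x0|/(root_neg rx) px] := pselect (nneg x).
  by rewrite !nneg_wactV //; have := uE x; tauto.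
have inv_opp v : inv v (- x) <-> nneg (wact v^-1%g x).
  by rewrite /inv wactN opprK; tauto.
by rewrite -!inv_opp uE mxE xs oppr0; tauto.
Qed.

(* [projk k w p]: [p] is the largest element below [w] that is sortable with
   respect to the word read off from [k] (see [projk_max]). *)
Inductive projk : nat -> W -> W -> Prop :=
| proj_one k : projk k 1%g 1%g
| proj_desc k w p : ldes (L k) w -> projk k.+1 (S (L k) * w)%g p ->
    projk k w (S (L k) * p)%g
| proj_skip k w u p : ~~ ldes (L k) w -> is_part (L k) w u ->
    projk k.+1 u p -> projk k w p.

Lemma ldes_below_gen s w p : ldes s w -> le p (S s * w)%g -> ldes s p = false.
Proof.
by move=> sw pw; apply/negP => /(ldes_le pw); rewrite ldes_gen sw.
Qed.

Lemma le_gen_mul s w p : ldes s w -> le p (S s * w)%g -> le (S s * p)%g w.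
Proof.
move=> sw pw; have sp : ldes s (S s * p)%g.
  by rewrite ldes_gen (ldes_below_gen sw pw).
by apply/(weak_le_mull sp sw); rewrite gen_mulKg.
Qed.

Lemma projk_sort k w p : projk k w p -> le p w /\ sortk k p.
Proof.
elim=> {k w p} [k|k w p kw _ [pw sp]|k w u p kw uE _ [pu sp]].
- by split; [apply: weak_le_refl|apply: sort_one].
- split; first exact: le_gen_mul.
  apply: sort_desc; last by rewrite gen_mulKg.
  by rewrite ldes_gen (ldes_below_gen kw pw).
- split; first exact: weak_le_trans pu (is_part_le uE).
  by apply: sort_skip => //; apply: par_le pu (is_part_par uE).
Qed.

(** Induction on the length and, within it, on the distance from [k] to some left descent of [w],
    since a skip may leave [w] unchanged. *)
Lemma projk_ex k w : exists p, projk k w p.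
Proof.
elim/ltn_ind: (len w) {-2}w (erefl (len w)) k => l IH {}w lw k.
have [->|/ldes_ex[i iw]] := pselect (w = 1%g).
  by exists 1%g; apply: proj_one.
have rec u k' : (len u < len w)%N -> exists p, projk k' u p.
  by rewrite lw => ul; apply: (IH _ ul).
have desc k' : ldes (L k') w -> exists p, projk k' w p.
  move=> kw; have [p pE] := rec (S (L k') * w)%g k'.+1 kw.
  by exists (S (L k') * p)%g; apply: proj_desc.
have := posP k i; move: (pos k i) => d; elim: d k => [|d IHd] k di.
  by apply: desc; rewrite -[k]addn0 di.
have [|kw] := boolP (ldes (L k) w); first exact: desc.
have [u [_ uw uE]] := par_part (L k) w.
have [lt|ge] := ltnP (len u) (len w).
  by have [p pE] := rec u k.+1 lt; exists p; apply: proj_skip pE.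
have e := weak_le_eq uw ge; rewrite e in uE.
have [|p pE] := IHd k.+1; first by rewrite addSnnS.
by exists p; apply: proj_skip pE.
Qed.

Lemma projk_ldes k w p : projk k w p -> ldes (L k) p = ldes (L k) w.
Proof.
case=> {k w p} [k //|k w p kw pE|k w u p kw uE pE].
  by have [pw _] := projk_sort pE; rewrite ldes_gen kw (ldes_below_gen kw pw).
have [pu _] := projk_sort pE; rewrite (negPf kw); apply/negP => /(ldes_le pu).
by move=> /(ldes_le (is_part_le uE)); rewrite (negPf kw).
Qed.

Lemma projk_descV k w p : projk k w p -> ldes (L k) p ->
  projk k.+1 (S (L k) * w)%g (S (L k) * p)%g.
Proof.
move=> pE; rewrite (projk_ldes pE); case: pE => {k w p} [k|k w p kw pE _|].
- by rewrite ldes1.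
- by rewrite gen_mulKg.
- by move=> k w u p /negPf->.
Qed.

Lemma projk_skipV k w p : projk k w p -> ~~ ldes (L k) p ->
  exists u, is_part (L k) w u /\ projk k.+1 u p.
Proof.
move=> pE; rewrite (projk_ldes pE); case: pE => {k w p} [k _|k w p ->//|].
  exists 1%g; split; last exact: proj_one.
  by move=> x; split=> [/inv1|[/inv1]].
by move=> k w u p _ uE pE _; exists u.
Qed.

Lemma projk_1 k w : projk k w 1%g -> w = 1%g.
Proof.
move e : 1%g => p pE; elim: pE e => {k w p} [//|k w p kw pE _ e|k w u p kw uE pE IH e].
  have [pw _] := projk_sort pE.
  have := ldes_gen (L k) p; rewrite -e ldes1 (ldes_below_gen kw pw).
  by [].
have u1 := IH e; rewrite -e in u1 *; have [//|/ldes_ex[i iw]] := pselect (w = 1%g).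
have [ik|ik] := eqVneq i (L k); first by rewrite ik (negPf kw) in iw.
suff /inv1 : inv 1%g (sroot i) by [].
rewrite -u1; apply/uE; split; first exact/ldesP.
by rewrite srootE eq_sym (negPf ik).
Qed.

(* The walls of the cone of all [w] whose projection is a given sortable
   element (Reading and Speyer). *)
Inductive cone : nat -> W -> vec -> Prop :=
| cone_one k i : cone k 1%g (sroot i)
| cone_first k v : par (L k) v -> cone k v (sroot (L k))
| cone_desc k v g : ldes (L k) v -> cone k.+1 (S (L k) * v)%g g ->
    cone k v (refl (L k) g)
| cone_skip k v g : par (L k) v -> cone k.+1 v g -> g (L k) 0 = 0 -> cone k v g.

Lemma cone_witness k v g : cone k v g -> exists h q,
  [/\ g = wact h (sroot q), le h v &
    forall b, inv v b -> ~ inv h b -> 0 <= om k g b /\ (om k g b = 0 -> form g b = 0)].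
Proof.
elim=> {k v g} [k i|k v pv|k v g kv _ [h [q [gE hv hb]]]|k v g pv _ [h [q [gE hv hb]]] gk].
- by exists 1%g, i; split=> [||b /inv1//]; rewrite ?wact1 // weak_le_refl.
- exists 1%g, (L k); split=> [||b vb _]; rewrite ?wact1 //; first exact: weak_le1.
  split; first by apply: om_first_ge0; case: vb => -[].
  apply: om_first_eq0; first by case: vb.
  by move=> bE; have := pv _ vb; rewrite bE srootE eqxx => /eqP; rewrite oner_eq0.
- have kh := ldes_below_gen kv hv.
  exists (S (L k) * h)%g, q; split=> [||b vb nhb].
  + by rewrite wactM wact_gen -gE.
  + exact: le_gen_mul.
  have pb := vb.1; have nb : b <> sroot (L k).
    by move=> bE; apply: nhb; rewrite bE; apply/ldesP; rewrite ldes_gen kh.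
  have [||o1 o2] := hb (refl (L k) b).
  + exact/(inv_refl _ pb nb).
  + by move=> /(inv_refl' _ pb nb).
  rewrite -(om_refl k) reflK; split=> // /o2.
  by rewrite -[form (refl _ _) _](form_refl (L k)) reflK.
- exists h, q; split=> // b vb nhb; have [o1 o2] := hb b vb nhb.
  by rewrite -om_par // (pv _ vb).
Qed.

Lemma cone_root k v g : cone k v g -> root g.
Proof.
by move=> /cone_witness[h [q [-> _ _]]]; apply: root_wact; apply: root_sroot.
Qed.

Lemma projk_cone k w p g : projk k w p -> cone k p g -> nneg (wact w^-1%g g).
Proof.
move=> pE gE; elim: gE w pE => {k p g} [k i w /projk_1->|k p pp w pE|k p g kp _ IH w pE|].
- by rewrite invg1 wact1; apply: nneg_sroot.
- have := projk_ldes pE; rewrite (negPf (par_ldesN pp)) => /esym/negbT kw.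
  by apply: wact_sroot_nneg; rewrite leqNgt.
- by have := IH _ (projk_descV pE kp); rewrite invMg gen_invg wactM wact_gen.
- move=> k p g pp gE IH gk w pE.
  have [u [uE /IH]] := projk_skipV pE (par_ldesN pp).
  by rewrite (is_part_nneg uE) //; apply: cone_root gE.
Qed.

Lemma cone_projk k v w : sortk k v -> le v w ->
  (forall g, cone k v g -> nneg (wact w^-1%g g)) -> projk k w v.
Proof.
move=> sv; elim: sv w => {k v} [k w _ gw|k v kv sv IH w vw gw|k v pv sv IH w vw gw].
- have [->|/ldes_ex[i /ldesP iw]] := pselect (w = 1%g); first exact: proj_one.
  by have /(nneg_wactV _ (posroot_sroot i)) := gw _ (cone_one k i).
- have kw := ldes_le vw kv; rewrite -(gen_mulKg (L k) v); apply: proj_desc => //.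
  apply: IH; first exact/(weak_le_mull kv kw).
  move=> g gE; have := gw _ (cone_desc kv gE).
  by rewrite invMg gen_invg wactM wact_gen.
- have kw : ~~ ldes (L k) w.
    apply/ldesP; apply/(nneg_wactV _ (posroot_sroot _)); apply: gw.
    exact: cone_first.
  have [u [pu uw uE]] := par_part (L k) w.
  apply: (proj_skip kw uE); apply: IH; first exact: is_part_max uE pv vw.
  move=> g gE; have rg := cone_root gE; have [gk|gk] := eqVneq (g (L k) 0) 0.
    by rewrite (is_part_nneg uE) //; apply: gw; apply: cone_skip.
  (* A wall dropped by [cone_skip] has coordinate 1 at [L k]. The parabolic [u] preserves this
     coordinate, so the wall condition holds by itself. *)
  have [h [q [gh hv _]]] := cone_witness gE.
  have g1 : g (L k) 0 = 1.
    move: gk; rewrite gh (parP _ _).1 ?srootE; last exact: par_le hv pv.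
    by have [//|_] := eqVneq (L k) q; rewrite mulr0n eqxx.
  have [] : posroot (wact u^-1%g g) => //.
  apply: root_pos; first exact: root_wact.
  move=> /(_ (L k)); have := (parP (L k) u).1 pu (wact u^-1%g g).
  by rewrite wactVK g1 => e; rewrite mxE -e oppr_ge0 ler10.
Qed.

Lemma sortk_shift k d w : (forall e, (e < d)%N -> par (L (k + e)%N) w) ->
  sortk (k + d)%N w -> sortk k w.
Proof.
elim: d k => [|d IH] k pw; first by rewrite addn0.
rewrite -addSnnS => sw; apply: sort_skip.
  by have := pw 0%N isT; rewrite addn0.
by apply: IH => // e ed; rewrite addSnnS; apply: pw.
Qed.

(** Read from [k.+1], the letter [s] comes before [L k], so the word is met letter by letter, and
    all letters in between lie outside its support. *)
Lemma sortk_alt k s (j : nat) : s != L k -> len (alt s (L k) j) = j ->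
  sortk k.+1 (alt s (L k) j).
Proof.
elim: j k s => [|j IH] k s sk lj; first exact: sort_one.
set r := L k in sk lj *; pose k' := (k.+1 + pos k.+1 s)%N.
have Lk' : L k' = s by rewrite posP.
have lj' : len (alt r s j) = j.
  apply/eqP; rewrite eqn_leq alt_len -ltnS -lj; exact: len_genM.
apply: (@sortk_shift _ (pos k.+1 s)) => [e es|].
  apply/parP => x; apply: wact_alt_coord.
    by apply: contraTneq es => /pos_min; rewrite -leqNgt.
  apply/eqP/nesym/L_inj; rewrite addSnnS -[X in (X < _)%N]addn0 !ltn_add2l /=.
  exact: leq_ltn_trans es (pos_lt _ _).
apply: sort_desc; rewrite -/k' Lk' altS.
  by rewrite /ldes gen_mulKg -altS lj lj'.
rewrite gen_mulKg -{1}Lk'; have := IH k' r; rewrite Lk'; apply=> //.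
by rewrite eq_sym.
Qed.

(** The assumption is the induction hypothesis of [projk_max]. If [s] and [L k] are both descents of
    [w], so is their dihedral join below [w]; without its first letter [L k] it is sortable by
    [sortk_alt], hence below the shorter projection. *)
Lemma projk_ldes_any l k (z p : W) s :
  (forall w, (len w < l)%N -> forall k v (p : W), sortk k v -> le v w ->
     projk k w p -> le v p) ->
  projk k z p -> (len z <= l)%N -> ldes s z -> ldes s p.
Proof.
move=> IH; elim=> {k z p} [k //|k w p kw pE _ lw sw|k w u p kw uE pE IHp lw sw].
  have [pw _] := projk_sort pE; have kp := ldes_below_gen kw pw.
  have [->|sk] := eqVneq s (L k); first by rewrite ldes_gen kp.
  have [[|j] [lj sj [_ kj lub]]] := dihedral_join sk sw kw.
    by rewrite ldes1 in sj.
  rewrite weak_le_genE in kj.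
  have jw : le (alt (L k) s j.+1) w by apply: lub; rewrite weak_le_genE.
  have kjE : (S (L k) * alt (L k) s j.+1 = alt s (L k) j)%g by rewrite altS gen_mulKg.
  have jp : le (alt s (L k) j) p.
    apply: (IH _ _ k.+1 _ _ _ _ pE).
    + by apply: leq_trans lw; rewrite (ldes_len kw).
    + apply: sortk_alt => //; apply/eqP; rewrite eqn_leq alt_len -ltnS -lj.
      exact: len_genM.
    by rewrite -kjE; apply/(weak_le_mull kj kw).
  have kSp : ldes (L k) (S (L k) * p)%g by rewrite ldes_gen kp.
  by apply: ldes_le sj; apply/(weak_le_mull kj kSp); rewrite kjE gen_mulKg.
apply: IHp; first exact: leq_trans (weak_le_len (is_part_le uE)) lw.
have sk : s != L k by apply: contraNneq kw => <-.
apply/ldesP/uE; split; first exact/ldesP.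
by rewrite srootE eq_sym (negPf sk).
Qed.

(* Let [x = s z], which is covered by [z], and let [x'] be its projection with
   respect to the next word, in which [s] is final.  If [s] were not a wall of
   the cone of [x'], then [z] would lie in this cone as well, so [s <= x'].
   Hence [s] is a wall; since [s] is initial for the letter skipped at that wall
   and final for the whole word, the inversions of [x'] are stable under [s].
   So [s x'] is an upper bound of [s] and [v], which forces [x' = x]. *)
Lemma join_gen_sort l k v (z : W) :
  (forall w, (len w < l)%N -> forall k v (p : W), sortk k v -> le v w ->
     projk k w p -> le v p) ->
  (len z <= l)%N -> sortk k v -> ~~ ldes (L k) v -> is_join (S (L k)) v z ->
  sortk k z.
Proof.
set s := L k => IH zl sv nsv zJ; have [pv sv'] := sortk_skip sv nsv.
have [sz vx [r [rx uz we]]] := join_gen_cover zJ pv.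
set x : W := (S s * z)%g in vx rx uz we.
have nsx : ~~ ldes s x by rewrite ldes_gen sz.
have xz : le x z by rewrite -uz; apply: weak_le_mulr.
have lz : len z = (len x).+1 :> nat by rewrite (ldes_len sz).
have xl : (len x < l)%N by rewrite -lz.
have [x' pE] := projk_ex k.+1 x; have [x'x sx'] := projk_sort pE.
have vx' : le v x' := IH _ xl _ _ _ sv' vx pE.
have nsx' : ~~ ldes s x' by apply: contra nsx; apply: ldes_le.
suff x'E : x' = x by apply: sort_desc; rewrite // -/s -/x -x'E.
have wall : cone k.+1 x' (sroot s).
  apply: contrapT => nwall; case/negP: nsx'.
  apply: (projk_ldes_any IH _ zl sz); apply: (cone_projk sx').
    exact: weak_le_trans x'x xz.
  move=> g gE; have rg := cone_root gE.
  rewrite -uz invMg gen_invg wactM wact_gen.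
  have pd : posroot (wact x^-1%g g).
    by split; [apply: root_wact|apply: projk_cone gE].
  suff /(posroot_refl pd)[] : wact x^-1%g g <> sroot r by [].
  by move=> /(congr1 (wact x)); rewrite wactVK we => gs; rewrite gs in gE.
have [h [q [sE hx' hb]]] := cone_witness wall.
have hq := wact_conj (esym sE).
have stable b : inv x' b -> inv x' (refl s b).
  move=> xb; have pb := xb.1; have bs : b <> sroot s.
    by move=> bE; move: xb; rewrite bE => /ldesP; rewrite (negPf nsx').
  (* Within [h], conjugation turns [s] into the simple reflection [q], which keeps the negative
     image of [b] negative. *)
  have [hinv|nhb] := pselect (inv h b).
    apply: (weak_leP h x').1 => //; split; first exact: posroot_refl.
    rewrite -wact_gen -wactM.
    have -> : (h^-1 * S s = S q * h^-1)%g.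
      by apply: (mulgI h); rewrite mulKVg mulgA hq mulgK.
    rewrite wactM wact_gen -wact_gen -wactN wact_gen.
    have pd : posroot (- wact h^-1%g b).
      split; last by case: hinv.
      by apply: root_opp; apply: root_wact; case: pb.
    suff /(posroot_refl pd)[] : - wact h^-1%g b <> sroot q by [].
    move=> /(congr1 (wact h)); rewrite wactN wactVK -sE => bE.
    apply: (@posroot_not_neg (sroot s)); first exact: posroot_sroot.
    by rewrite -bE opprK; case: pb.
  (* Beyond [h], the skew form is nonnegative by the wall and nonpositive since [s] is the last
     letter from [k.+1]; so it is zero, and [s] fixes [b]. *)
  have [o1 o2] := hb b xb nhb; have o3 := om_last_le0 k pb.2; rewrite -/s in o3.
  suff -> : refl s b = b by [].
  rewrite /refl formC o2 ?scale0r ?subr0 //.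
  by apply/le_anti; rewrite o1 o3.
have zsx' : le z (S s * x')%g.
  have [_ _ lub] := zJ; apply: lub; first by rewrite weak_le_genE ldes_gen.
  apply/weak_leP => b vb; have pb := vb.1.
  have bs : b <> sroot s.
    by move=> bE; move: vb; rewrite bE => /ldesP; rewrite (negPf nsv).
  apply/(inv_refl' _ pb bs); apply: stable.
  by move: vb; apply: (weak_leP v x').1.
apply: (weak_le_eq x'x); have := weak_le_len zsx'.
by rewrite lz (ldesN_len nsx') ltnS.
Qed.

Theorem projk_max k w v p : sortk k v -> le v w -> projk k w p -> le v p.
Proof.
elim/ltn_ind: (len w) {-2}w (erefl (len w)) k v p => l IH0 {}w lw k v p sv vw pE.
have IH u : (len u < l)%N -> forall k v (p : W), sortk k v -> le v u ->
    projk k u p -> le v p.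
  by move=> ul; apply: (IH0 _ ul).
have {lw} : (len w <= l)%N by rewrite lw.
elim: pE v sv vw => {k w p} [k v _ //|k w p kw pE IHp v sv vw wl|].
  have [pw _] := projk_sort pE.
  have le_p u : sortk k u -> ldes (L k) u -> le u w -> le u (S (L k) * p)%g.
    move=> su ku uw; have kp : ldes (L k) (S (L k) * p)%g.
      by rewrite ldes_gen (ldes_below_gen kw pw).
    apply/(weak_le_mull ku kp); rewrite gen_mulKg; apply: IHp.
    - exact: sortk_desc.
    - exact/(weak_le_mull ku kw).
    - by rewrite ltnW // -(ldes_len kw).
  have [kv|kv] := boolP (ldes (L k) v); first exact: le_p.
  (* Here [v] is replaced by its join with the first letter, still below [w]. *)
  have kw' : le (S (L k)) w by rewrite weak_le_genE.
  have [z zJ] := join_exists kw' vw; have [kz vz lub] := zJ.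
  have zw := lub _ kw' vw; apply: weak_le_trans vz _; apply: le_p => //.
    by apply: (join_gen_sort IH _ sv kv zJ); apply: leq_trans (weak_le_len zw) wl.
  by rewrite -weak_le_genE.
move=> k w u p kw uE pE IHp v sv vw wl.
have kv : ~~ ldes (L k) v by apply: contra kw; apply: ldes_le.
have [pv sv'] := sortk_skip sv kv; apply: IHp => //.
  exact: is_part_max uE pv vw.
exact: leq_trans (weak_le_len (is_part_le uE)) wl.
Qed.

Lemma sortk_join k v (z : W) : sortk k v -> ~~ ldes (L k) v ->
  is_join (S (L k)) v z -> sortk k z.
Proof.
move=> sv kv zJ; apply: (join_gen_sort (l := len z) _ _ sv kv zJ) => //.
move=> w _ k' v' p; exact: projk_max.
Qed.

(** * Sorting words *)

Definition word_value (r : seq nat) : W := \prod_(a <- r) S (L a).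

Lemma word_value_cons a r : word_value (a :: r) = (S (L a) * word_value r)%g.
Proof. by rewrite /word_value big_cons. Qed.

Lemma len_word_value r : (len (word_value r) <= size r)%N.
Proof.
elim: r => [|a r IH]; first by rewrite /word_value big_nil cox_length1.
by rewrite word_value_cons; apply: leq_trans (len_genM _ _) _.
Qed.

Definition reduced_at k w (r : seq nat) : Prop :=
  [/\ sorted ltn r, all (leq k) r, word_value r = w & size r = len w].

Lemma reduced_at_nil k : reduced_at k 1%g [::].
Proof. by split; rewrite ?cox_length1 // /word_value big_nil. Qed.

Lemma reduced_at_1 k r : reduced_at k 1%g r -> r = [::].
Proof. by case=> _ _ _; rewrite cox_length1 => /size0nil. Qed.

Lemma reduced_at_nilV k w : reduced_at k w [::] -> w = 1%g.
Proof. by case=> _ _ _ /esym/cox_length_eq0. Qed.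

Lemma reduced_at_cons k a w r : reduced_at k w (a :: r) ->
  [/\ (k <= a)%N, ldes (L a) w & reduced_at a.+1 (S (L a) * w)%g r].
Proof.
case=> /= ar /andP[ka kr] wE lw; have wr : (S (L a) * w = word_value r)%g.
  by rewrite -wE word_value_cons gen_mulKg.
have ls : ldes (L a) w by rewrite /ldes wr -lw ltnS len_word_value.
split=> //; split=> //; first exact: path_sorted ar.
  exact: (order_path_min ltn_trans ar).
by apply/eqP; rewrite -eqSS lw (ldes_len ls).
Qed.

Lemma reduced_at_consV k a w r : (k <= a)%N -> ldes (L a) w ->
  reduced_at a.+1 (S (L a) * w)%g r -> reduced_at k w (a :: r).
Proof.
move=> ka aw [sr ar wE lr]; split=> /=.
- by rewrite path_min_sorted.
- rewrite ka; apply: sub_all ar => b ab; exact: leq_trans ka (ltnW ab).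
- by rewrite word_value_cons wE gen_mulKg.
- by rewrite lr (ldes_len aw).
Qed.

Lemma reduced_at_leq k l w r : (k <= l)%N -> reduced_at l w r -> reduced_at k w r.
Proof.
by move=> kl [? ar ? ?]; split=> //; apply: sub_all ar => b; apply: leq_trans.
Qed.

Lemma reduced_atS k w a r : reduced_at k w (a :: r) -> a != k ->
  reduced_at k.+1 w (a :: r).
Proof.
move=> /reduced_at_cons[ka aw rE] nak; apply: reduced_at_consV => //.
by rewrite ltn_neqAle eq_sym nak.
Qed.

Lemma reduced_at_par k w r s : reduced_at k w r -> par s w ->
  forall a, a \in r -> L a <> s.
Proof.
elim: r k w => // b r IH k w /reduced_at_cons[_ bw rE] pw a.
rewrite in_cons => /orP[/eqP->|ar]; last by apply: IH rE (par_mull bw pw) _ ar.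
by move=> bs; have := par_ldesN pw; rewrite -bs bw.
Qed.

Lemma par_reduced_at k w r s : reduced_at k w r ->
  (forall a, a \in r -> L a <> s) -> par s w.
Proof.
case=> _ _ <- _ ns; apply/parP => x; elim: r ns => [|a r IH] ns.
  by rewrite /word_value big_nil wact1.
rewrite word_value_cons wactM wact_gen refl_coord.
  by apply: IH => b br; apply: ns; rewrite in_cons br orbT.
by apply/eqP => sa; apply: (ns a); rewrite ?mem_head.
Qed.

Definition lex_first_at k w r : Prop :=
  reduced_at k w r /\ forall q, reduced_at k w q -> (r <= q :> seqlexi nat)%O.

(** Position [a - n] is the same letter one copy earlier, so this is the nesting of blocks counted
    from [k]. *)
Definition nested_at k (r : seq nat) : Prop :=
  forall a, a \in r -> (k + n <= a)%N -> (a - n)%N \in r.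

Lemma n_gt0 : (0 < n)%N.
Proof. by have [d + _] := L_surj 0 (L 0); apply: leq_ltn_trans. Qed.

(** [L k] recurs among the next [n] positions, and injectivity leaves only the last of them. *)
Lemma L_per k : L (k + n)%N = L k.
Proof.
have [d dn di] := L_surj k.+1 (L k).
have [nd|nd] := leqP n.-1 d.
  by rewrite -di addSnnS; congr (L (_ + _)); move: n_gt0 dn nd; lia.
by case: (@L_inj k (k.+1 + d)) => //; move: n_gt0 dn nd; lia.
Qed.

(** The recursion reads the word greedily: a descent puts the least position [k] in front, while a
    skipped letter never occurs again, so [k + n] is absent too. *)
Lemma sortk_lex_first k w : sortk k w ->
  exists r, lex_first_at k w r /\ nested_at k r.
Proof.
elim=> {k w} [k|k w kw _ [r [[rE rmin] rn]]|k w pw _ [r [[rE rmin] rn]]].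
- exists [::]; split=> //; split; first exact: reduced_at_nil.
  by move=> q _; apply: Order.SeqLexiOrder.lexi0s.
- exists (k :: r); split; [split|].
  + exact: reduced_at_consV.
  + case=> [/reduced_at_nilV w1|a q qE]; first by rewrite w1 ldes1 in kw.
    have [ka _ qE'] := reduced_at_cons qE.
    rewrite Order.SeqLexiOrder.lexi_cons !leEnat ka; apply/implyP => ak.
    have e : a = k by apply/eqP; rewrite eqn_leq ka andbT.
    by apply: rmin; rewrite e in qE'.
  + move=> a; rewrite !in_cons => /orP[/eqP->|ar].
      by rewrite -{2}[k]addn0 leq_add2l leqNgt n_gt0.
    rewrite leq_eqVlt => /orP[/eqP<-|ka]; first by rewrite addnK eqxx.
    by rewrite (rn _ ar) ?orbT.
- exists r; split; [split|].
  + exact: reduced_at_leq rE.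
  + case=> [/reduced_at_nilV w1|a q qE]; last first.
      apply: rmin; apply: reduced_atS => //; apply/eqP => ak.
      have [_ + _] := reduced_at_cons qE.
      by rewrite ak (negPf (par_ldesN pw)).
    by move: rE; rewrite w1 => /reduced_at_1->.
  + move=> a ar; rewrite leq_eqVlt => /orP[/eqP ka|]; last exact: rn.
    by case: (reduced_at_par rE pw ar); rewrite -ka L_per.
Qed.

Lemma nested_sortk k w r : reduced_at k w r -> nested_at k r -> sortk k w.
Proof.
(* [N] bounds the positions still to be read; the size of [r] does not drop at a skip. *)
suff main N : all (gtn (k + N)%N) r -> reduced_at k w r -> nested_at k r ->
    sortk k w.
  apply: (main (\max_(a <- r) a).+1); apply/allP => a ar.
  have : (a <= \max_(b <- r) b)%N by apply: leq_bigmax_seq.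
  by move=> h; rewrite /gtn /= addnS ltnS (leq_trans h) // leq_addl.
elim: N k w r => [|N IH] k w r rN rE rn.
  case: r rE {rn} rN => [/reduced_at_nilV->|a r /reduced_at_cons[ka _ _]].
    by move=> _; apply: sort_one.
  by rewrite addn0 /= ltnNge ka.
have [rk|nrk] := boolP (k \in r).
  case: r rE rk rN rn => // a r rE; have [ka kw rE'] := reduced_at_cons rE.
  rewrite in_cons => kar rN rn; have ak : a = k.
    apply/eqP; rewrite eqn_leq ka andbT; case/orP: kar => [/eqP->//|kr].
    by case: rE' => _ /allP/(_ _ kr)/ltnW.
  rewrite {a}ak in ka kw rE' rn rN rE {kar} *.
  apply: sort_desc => //; apply: (IH _ _ r) => //.
    by rewrite addSnnS; case/andP: rN.
  move=> b br kb; have kb' : (k + n <= b)%N by apply: leq_trans kb; rewrite addSn.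
  have := rn b; rewrite !in_cons br orbT => /(_ isT kb') /orP[/eqP e|//].
  by move: kb; rewrite -(subnK (leq_trans (leq_addl _ _) kb')) e addSn ltnn.
have rE' : reduced_at k.+1 w r.
  case: r rE {rn rN} nrk => [[] //|a r rE]; rewrite in_cons negb_or => /andP[ka _].
  by apply: reduced_atS => //; rewrite eq_sym.
have rk a : a \in r -> (k < a)%N by case: rE' => _ /allP h _ _ /h.
(* Nesting moves an occurrence of [L k] back by [n] until it is less than [n] beyond [k], where only
   [k] itself carries this letter. *)
have nsk a : a \in r -> L a <> L k.
  elim/ltn_ind: a => a IHa ar; have [kn|kn] := leqP (k + n) a.
    have := IHa _ _ (rn _ ar kn); rewrite -[L (a - n)]L_per subnK; first apply.
      by rewrite -{2}(subnK (leq_trans (leq_addl k n) kn)) -{1}[(a - n)%N]addn0 ltn_add2l n_gt0.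
    exact: leq_trans (leq_addl _ _) kn.
  by apply/nesym/L_inj; rewrite rk.
apply: sort_skip; first exact: par_reduced_at rE nsk.
apply: (IH _ _ r) => //; first by rewrite addSnnS.
by move=> a ar ka; apply: rn => //; apply: leq_trans ka; rewrite addSn.
Qed.

(** * The labelling *)

Definition cover k u v : Prop :=
  [/\ sortk k u, sortk k v, le u v, u <> v &
    forall w, sortk k w -> le u w -> le w v -> w = u \/ w = v].

(* [l] is the least position occurring in the sorting word of [v] but not in that
   of [u]. *)
Inductive diff : nat -> W -> W -> nat -> Prop :=
| diff_here k u v : ~~ ldes (L k) u -> ldes (L k) v -> diff k u v k
| diff_desc k u v l : ldes (L k) u -> ldes (L k) v ->
    diff k.+1 (S (L k) * u)%g (S (L k) * v)%g l -> diff k u v l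
| diff_skip k u v l : ~~ ldes (L k) u -> ~~ ldes (L k) v ->
    diff k.+1 u v l -> diff k u v l.

(** By [diff_ex], covers never receive the default 0. *)
Definition label k u v : nat := xget 0%N [set l | diff k u v l]%classic.

Lemma eq_label k u v k' u' v' : (forall l, diff k u v l <-> diff k' u' v' l) ->
  label k u v = label k' u' v'.
Proof.
move=> h; rewrite /label; congr xget; apply/seteqP; split=> l.
  exact: (h l).1.
exact: (h l).2.
Qed.

Lemma label_here k u v : ~~ ldes (L k) u -> ldes (L k) v -> label k u v = k.
Proof.
move=> ku kv; have hereE l : diff k u v l -> l = k.
  by move=> d; case: d ku kv => [//|? ? ? ? -> //|? ? ? ? _ /negPf-> //].
by apply: hereE; apply: (xgetI 0%N (diff_here ku kv)).
Qed.

Lemma label_desc k u v : ldes (L k) u -> ldes (L k) v ->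
  label k u v = label k.+1 (S (L k) * u)%g (S (L k) * v)%g.
Proof.
move=> ku kv; apply: eq_label => l; split; last exact: diff_desc.
by move=> d; case: d ku kv => [? ? ? /negPf-> //|//|? ? ? ? /negPf-> //].
Qed.

Lemma label_skip k u v : ~~ ldes (L k) u -> ~~ ldes (L k) v ->
  label k u v = label k.+1 u v.
Proof.
move=> ku kv; apply: eq_label => l; split; last exact: diff_skip.
by move=> d; case: d ku kv => [? ? ? _ -> //|? ? ? ? -> //|//].
Qed.

Lemma diff_ex k u v : sortk k v -> sortk k u -> le u v -> u <> v ->
  exists l, diff k u v l.
Proof.
move=> sv; elim: sv u => {k v} [k|k v kv _ IH|k v pv _ IH] u su uv nuv.
- by case: nuv; apply: (weak_le_eq uv); rewrite cox_length1.
- have [ku|ku] := boolP (ldes (L k) u); last by exists k; apply: diff_here.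
  have [||/(mulgI (S (L k)))//|l dl] := IH (S (L k) * u)%g.
  + exact: sortk_desc.
  + exact/(weak_le_mull ku kv).
  + by exists l; apply: diff_desc.
- have ku := par_ldesN (par_le uv pv).
  have [|l dl] := IH u _ uv nuv; first by case: (sortk_skip su ku).
  by exists l; apply: diff_skip => //; apply: par_ldesN.
Qed.

Lemma diff_ge k u v l : diff k u v l -> (k <= l)%N.
Proof. by elim=> {k u v l} // k u v l _ _ _; apply: ltnW. Qed.

Lemma label_ge k u v : cover k u v -> (k <= label k u v)%N.
Proof.
case=> su sv uv nuv _; have [l dl] := diff_ex sv su uv nuv.
exact: diff_ge (xgetI 0%N dl).
Qed.

Lemma cover_skip k u v : par (L k) v -> cover k u v <-> cover k.+1 u v.
Proof.
move=> pv; have sP w : le w v -> sortk k w <-> sortk k.+1 w.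
  move=> wv; have pw := par_le wv pv.
  by split=> [/sortk_skip/(_ (par_ldesN pw))[]//|]; apply: sort_skip.
have vv := weak_le_refl S v.
split=> -[su sv uv nuv h]; split=> //; try exact/sP.
  by move=> w sw uw wv; apply: h => //; apply/sP.
by move=> w sw uw wv; apply: h => //; apply/sP.
Qed.

Lemma sortk_descE k w : ldes (L k) w -> sortk k w <-> sortk k.+1 (S (L k) * w)%g.
Proof. by move=> kw; split=> [/sortk_desc|]; [apply|apply: sort_desc]. Qed.

Lemma cover_desc k u v : ldes (L k) u -> ldes (L k) v ->
  cover k u v <-> cover k.+1 (S (L k) * u)%g (S (L k) * v)%g.
Proof.
move=> ku kv; split=> -[su sv uv nuv h].
  split; [exact/(sortk_descE ku)|exact/(sortk_descE kv)|exact/(weak_le_mull ku kv)| |].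
    by move/mulgI.
  move=> w sw uw wv; have kw : ldes (L k) (S (L k) * w)%g.
    by rewrite ldes_gen; apply/negP => /(ldes_le wv); rewrite ldes_gen kv.
  have [||||] := h (S (L k) * w)%g.
  - by apply/(sortk_descE kw); rewrite gen_mulKg.
  - by apply/(weak_le_mull ku kw); rewrite gen_mulKg.
  - by apply/(weak_le_mull kw kv); rewrite gen_mulKg.
  - by move=> <-; left; rewrite gen_mulKg.
  - by move=> <-; right; rewrite gen_mulKg.
split; [exact/(sortk_descE ku)|exact/(sortk_descE kv)|exact/(weak_le_mull ku kv)| |].
  by move=> uvE; apply: nuv; rewrite uvE.
move=> w sw uw wv; have kw := ldes_le uw ku.
have [||||] := h (S (L k) * w)%g.
- exact/(sortk_descE kw).
- exact/(weak_le_mull ku kw).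
- exact/(weak_le_mull kw kv).
- by move/mulgI; left.
- by move/mulgI; right.
Qed.

(** * Chains and their labels *)

Fixpoint chain k u (p : seq W) v : Prop :=
  if p is w :: p' then cover k u w /\ chain k w p' v else u = v.

Notation labels k := (pairmap (label k)).

Lemma chain_le k u p v : chain k u p v -> le u v.
Proof.
elim: p u => [u <-|w p IH u [[_ _ uw _ _] /IH wv]]; first exact: weak_le_refl.
exact: weak_le_trans uw wv.
Qed.

Lemma chain_refl k u p : chain k u p u -> p = [::].
Proof.
case: p => // w p [[_ _ uw nuw _] /chain_le wu]; case: nuw.
by apply: (@weak_le_anti W n S); rewrite uw.
Qed.

Lemma chain_skip k u p v : par (L k) v -> chain k u p v <-> chain k.+1 u p v.
Proof.
move=> pv; elim: p u => [|w p IH] u //=; rewrite IH.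
by split=> -[uw wv]; split=> //; have pw := par_le (chain_le wv) pv;
  apply/(cover_skip u pw).
Qed.

Lemma labels_skip k u p v : par (L k) v -> chain k u p v ->
  labels k u p = labels k.+1 u p.
Proof.
move=> pv; elim: p u => [|w p IH] u //= [[_ _ uw _ _] wv]; rewrite IH //.
have pw := par_le (chain_le wv) pv.
by rewrite label_skip // par_ldesN //; apply: par_le pw.
Qed.

Lemma chain_desc k u p v : ldes (L k) u -> chain k u p v ->
  chain k.+1 (S (L k) * u)%g (map (mul (S (L k))) p) (S (L k) * v)%g.
Proof.
elim: p u => [|w p IH] u ku /=; first by move=> ->.
move=> [uw wv]; have kw : ldes (L k) w.
  by case: uw => _ _ uw _ _; apply: ldes_le uw ku.
by split; [apply/(cover_desc ku kw)|apply: IH].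
Qed.

Lemma chain_descV k u p v : ldes (L k) u -> ldes (L k) v ->
  chain k.+1 (S (L k) * u)%g p (S (L k) * v)%g ->
  chain k u (map (mul (S (L k))) p) v.
Proof.
move=> + kv; elim: p u => [|w p IH] u ku /=; first by move=> /mulgI.
rewrite -[w in X in X -> _](gen_mulKg (L k)) => -[uw wv].
have kw : ldes (L k) (S (L k) * w)%g.
  rewrite ldes_gen; apply/negP; move: (chain_le wv); rewrite gen_mulKg.
  by move=> /ldes_le/[apply]; rewrite ldes_gen kv.
by split; [apply/(cover_desc ku kw)|apply: IH].
Qed.

Lemma labels_desc k u p v : ldes (L k) u -> chain k u p v ->
  labels k u p = labels k.+1 (S (L k) * u)%g (map (mul (S (L k))) p).
Proof.
elim: p u => [|w p IH] u ku //= [[_ _ uw _ _] wv].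
by have kw := ldes_le uw ku; rewrite (IH w) // label_desc.
Qed.

Lemma labels_ge k u p v : chain k u p v -> all (leq k) (labels k u p).
Proof.
elim: p u => [|w p IH] u //= [uw /IH ->]; by rewrite andbT label_ge.
Qed.

Lemma labels_desc_gt k u p v : ldes (L k) u -> chain k u p v ->
  all (ltn k) (labels k u p).
Proof. by move=> ku uv; rewrite (labels_desc ku uv) (labels_ge (chain_desc ku uv)). Qed.

Lemma label_in_labels k u p v : ~~ ldes (L k) u -> ldes (L k) v ->
  chain k u p v -> k \in labels k u p.
Proof.
move=> + kv; elim: p u => [|w p IH] u ku /=; first by move=> uv; rewrite uv kv in ku.
move=> [uw wv]; rewrite in_cons; have [kw|kw] := boolP (ldes (L k) w).
  by rewrite label_here // eqxx.
by rewrite (IH w) ?orbT.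
Qed.

Definition EL_interval k u v : Prop := exists p,
  [/\ chain k u p v, sorted <%O (labels k u p),
    forall q, chain k u q v -> sorted <%O (labels k u q) -> q = p &
    forall q, chain k u q v ->
      (labels k u p <= labels k u q :> seqlexi nat)%O].

Lemma EL_interval_desc k u v : ldes (L k) u -> ldes (L k) v ->
  EL_interval k.+1 (S (L k) * u)%g (S (L k) * v)%g -> EL_interval k u v.
Proof.
move=> ku kv [p [pc pr pu pl]]; pose f := map (mul (S (L k))).
have fK : cancel f f by apply: mapK => w; apply: gen_mulKg.
have fpc := chain_descV ku kv pc.
have fpl : labels k u (f p) = labels k.+1 (S (L k) * u)%g p.
  by rewrite (labels_desc ku fpc) [map _ _]fK.
exists (f p); split=> //; first by rewrite fpl.
  move=> q qc; rewrite (labels_desc ku qc) => qr.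
  by apply: (can_inj fK); rewrite fK; apply: pu => //; apply: chain_desc.
by move=> q qc; rewrite fpl (labels_desc ku qc); apply: pl; apply: chain_desc.
Qed.

(* If [s = L k] is below [v] but not below [u], every maximal chain has exactly one
   label [k], the least possible one, so a rising chain must start with it; the
   only cover of [u] above [s] is the join of [s] and [u]. *)
Theorem EL_intervalP k u v : sortk k v -> sortk k u -> le u v ->
  EL_interval k u v.
Proof.
move=> sv; elim: sv u => {k v} [k|k v kv sv IH|k v pv _ IH] u su uv.
- have -> : u = 1%g by apply: (weak_le_eq uv); rewrite cox_length1.
  exists [::]; split=> // q /chain_refl-> //; exact: lexx.
- have desc w : sortk k w -> le w v -> ldes (L k) w -> EL_interval k w v.
    move=> sw wv kw; apply: EL_interval_desc => //; apply: IH.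
      exact: sortk_desc.
    exact/(weak_le_mull kw kv).
  have [ku|ku] := boolP (ldes (L k) u); first exact: desc.
  have kv' : le (S (L k)) v by rewrite weak_le_genE.
  have [z zJ] := join_exists kv' uv; have [kz uz lub] := zJ.
  have sz := sortk_join su ku zJ; have zv := lub _ kv' uv.
  rewrite weak_le_genE in kz; have [pu _] := sortk_skip su ku.
  have [p [pc pr pun pl]] := desc _ sz zv kz.
  have nuz : u <> z by move=> uzE; rewrite uzE kz in ku.
  (* An intermediate element above [L k] is above the join; otherwise it is parabolic and
     [join_gen_par] puts it below [u]. *)
  have uzc : cover k u z.
    split=> // w sw uw wz; have [kw|kw] := boolP (ldes (L k) w).
      right; apply: (@weak_le_anti W n S); rewrite wz lub //.
      by rewrite weak_le_genE.
    left; apply: (@weak_le_anti W n S); rewrite uw andbT.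
    by have [pw _] := sortk_skip sw kw; apply: join_gen_par zJ pu pw wz.
  have first_step w q : cover k u w -> chain k w q v ->
      w = z \/ ~~ ldes (L k) w /\ (k < label k u w)%N.
    move=> uw wv; have [kw|kw] := boolP (ldes (L k) w).
      case: (uw) => _ _ uw' nuw h; left.
      have zw : le z w by apply: lub => //; rewrite weak_le_genE.
      by have [zu|->] := h z sz uz zw; [case: nuz|].
    right; split=> //; rewrite label_skip //.
    case: (uw) => _ sw _ _ _; have [pw _] := sortk_skip sw kw.
    by apply: label_ge; apply/(cover_skip u pw).
  exists (z :: p); split=> //.
  + rewrite /= label_here // path_min_sorted //.
    exact: labels_desc_gt pc.
  + case=> [/= uvE|w q /= [uw wv] qr]; first by rewrite uvE kv in ku.
    have [wz|[kw klt]] := first_step _ _ uw wv.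
      by rewrite wz in wv qr *; rewrite (pun q) //; apply: path_sorted qr.
    (* The label [k] is still to come after a larger first label, so the chain is not rising. *)
    have := label_in_labels kw kv wv.
    move=> /(allP (order_path_min lt_trans qr)); rewrite ltEnat /= ltnNge.
    by rewrite (ltnW klt).
  + case=> [/= uvE|w q /= [uw wv]]; first by rewrite uvE kv in ku.
    rewrite Order.SeqLexiOrder.lexi_cons !leEnat label_here //.
    have [wz|[kw klt]] := first_step _ _ uw wv.
      by rewrite wz in wv *; rewrite label_here // leqnn /=; apply: pl.
    by rewrite (ltnW klt) leqNgt klt.
- have pu := par_le uv pv.
  have [_ su'] := sortk_skip su (par_ldesN pu).
  have [p [pc pr pun pl]] := IH u su' uv.
  have lE q : chain k u q v -> labels k u q = labels k.+1 u q.
    exact: labels_skip.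
  have cE q : chain k u q v <-> chain k.+1 u q v by apply: chain_skip.
  have pc' : chain k u p v by apply/cE.
  exists p; split=> //; first by rewrite lE.
    by move=> q qc; rewrite lE // => qr; apply: pun => //; apply/cE.
  by move=> q qc; rewrite !lE //; apply: pl; apply/cE.
Qed.

End Sorting.

(** * Cambrian intervals *)

Section Interval.
Variables (c : 'S_n) (n0 : (0 < n)%N).

Definition letter (k : nat) : 'I_n := c (Ordinal (ltn_pmod k n0)).

Lemma letter_inj k l : (k < l < k + n)%N -> letter k <> letter l.
Proof.
move=> /andP[kl ln] /perm_inj/(congr1 val) /= /eqP.
rewrite -(subnKC (ltnW kl)) -{1}[k]addn0 eqn_modDl mod0n modn_small.
  by rewrite eq_sym subn_eq0 leqNgt kl.
by rewrite ltn_subLR // ltnW.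
Qed.

Lemma letter_surj k i : exists2 d, (d < n)%N & letter (k + d)%N = i.
Proof.
(* The distance is [j - k] modulo [n], with [n - k %% n] standing for [- k]. *)
pose j := (c^-1)%g i; exists ((j + (n - k %% n)) %% n)%N; first exact: ltn_pmod.
rewrite -[RHS](permKV c) -/j; congr (c _); apply: val_inj => /=.
rewrite modnDmr -modnDml addnCA subnKC ?(ltnW (ltn_pmod _ n0)) //.
by rewrite modnDr modn_small.
Qed.

Notation rank := (@rank_position n).

Definition unrank (a : nat) : position n := ((a %/ n)%N, Ordinal (ltn_pmod a n0)).

Lemma rankK : cancel rank unrank.
Proof.
case=> i j; rewrite /rank_position /unrank /=; congr (_, _).
  by rewrite divnMDl // divn_small ?addn0.
by apply: val_inj; rewrite /= modnMDl modn_small.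
Qed.

Lemma unrankK : cancel unrank rank.
Proof. by move=> a; rewrite /rank_position /= -divn_eq. Qed.

Lemma letter_rank p : letter (rank p) = c p.2.
Proof. by congr (c _); apply: (congr1 snd (rankK p)). Qed.

Lemma reduced_subwordE w p :
  reduced_subword S c w p <-> reduced_at letter 0 w (map rank p).
Proof.
have e : word_value letter (map rank p) = subword_value S c p.
  rewrite /word_value big_map; apply: eq_bigr => a _; by rewrite letter_rank.
split=> [[sp pw lp]|[sp _ pw lp]]; split=> //.
- by apply/allP.
- by rewrite e.
- by rewrite size_map.
- by rewrite -e.
- by rewrite -lp size_map.
Qed.

Lemma sorting_wordE w p :
  sorting_word S c w p <-> lex_first_at letter 0 w (map rank p).
Proof.
split=> -[/reduced_subwordE pE pmin]; split=> // q qE.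
  have e : map rank (map unrank q) = q by rewrite (mapK unrankK).
  by rewrite -e; apply: pmin; apply/reduced_subwordE; rewrite e.
by apply: pmin; apply/reduced_subwordE.
Qed.

Lemma nestedE p : (forall i : nat, block c p i.+1 \subset block c p i) <->
  nested_at 0 (map rank p).
Proof.
split=> [sub _ /mapP[[i j] ijp ->]|nest i].
  rewrite add0n; case: i ijp => [|i] ijp; first by rewrite leqNgt ltn_ord.
  have : c j \in block c p i.
    by apply: (fintype.subsetP (sub i)); apply/imsetP; exists j; rewrite // inE.
  move=> /imsetP[j' + /perm_inj jj']; rewrite inE -jj' => ijp' _.
  by apply/mapP; exists (i, j); rewrite // /rank_position mulSn -addnA addKn.
apply/fintype.subsetP => _ /imsetP[j + ->]; rewrite inE => ijp.
apply/imsetP; exists j => //; rewrite inE.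
have /(nest _) : rank (i.+1, j) \in map rank p by apply: map_f.
rewrite add0n /rank_position mulSn -addnA leq_addr addKn => /(_ isT).
by rewrite -[(_ + _)%N]/(rank (i, j)) (mem_map (can_inj rankK)).
Qed.

Lemma sortableE w : sortable S c w <-> sortk letter 0 w.
Proof.
split=> [[p /sorting_wordE pE /nestedE pn]|].
  exact: (nested_sortk letter_inj letter_surj pE.1 pn).
move=> /(sortk_lex_first letter_inj letter_surj)[r [rE rn]].
have e : map rank (map unrank r) = r by rewrite (mapK unrankK).
exists (map unrank r); first by apply/sorting_wordE; rewrite e.
by apply/nestedE; rewrite e.
Qed.

Variables (x y : weak_order S).
Hypotheses (Cx : cambrian c x) (Cy : cambrian c y) (xy : (x <= y)%O).

Notation P := (cambrian_interval c x y).

Lemma interval_sortk (z : weak_order S) :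
  P z <-> [/\ sortk letter 0 z, le x z & le z y].
Proof. by split=> -[/sortableE]. Qed.

Lemma interval_covers (u v : weak_order S) : P u -> P v ->
  covers P u v <-> cover letter 0 u v.
Proof.
move=> Pu Pv; split=> [[_ _ uv none]|[su sv uv nuv none]].
  have [/interval_sortk[su xu uy] /interval_sortk[sv xv vy]] := (Pu, Pv).
  have := uv; rewrite lt_neqAle => /andP[/eqP nuv leuv].
  split=> // w sw uw wv.
  have [->|/eqP nwu] := eqVneq w u; first by left.
  have [->|/eqP nwv] := eqVneq w v; first by right.
  case: none; exists w; split; rewrite ?lt_neqAle.
  - by apply/interval_sortk; split=> //; [apply: weak_le_trans xu uw|apply: weak_le_trans wv vy].
  - by apply/andP; split=> //; apply/eqP => e; apply: nwu.
  - by apply/andP; split=> //; apply/eqP.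
split=> //; first by rewrite lt_neqAle; apply/andP; split=> //; apply/eqP.
move=> [w [/interval_sortk[sw _ _]]]; rewrite !lt_neqAle.
move=> /andP[/eqP nuw uw] /andP[/eqP nwv wv].
by case: (none w sw uw wv) => e; [apply: nuw|apply: nwv].
Qed.

Lemma interval_chain (u v : weak_order S) (p : seq W) : P u -> P v ->
  maximal_chain P u v p <-> chain letter 0 u p v.
Proof.
move=> Pu Pv; elim: p u Pu => [|w p IH] u Pu /=; first by split=> [[]|].
split=> [[/= /andP[/asboolP uw wp] pv]|[uw wv]].
  have Pw : P w by case: uw.
  by split; [apply/interval_covers|apply/(IH w Pw); split].
have Pw : P w.
  have [/interval_sortk[_ xu _] /interval_sortk[_ _ vy]] := (Pu, Pv).
  have [_ sw uw' _ _] := uw; apply/interval_sortk; split=> //.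
    exact: weak_le_trans xu uw'.
  exact: weak_le_trans (chain_le wv) vy.
have [wp pv] := (IH w Pw).2 wv; split=> //=; rewrite wp andbT.
by apply/asboolP/interval_covers.
Qed.

Lemma finite_interval : finite_set P.
Proof.
pose f (u : (len y).-bseq 'I_n) : weak_order S := eval_word S u.
apply: (@sub_finite_set _ _ (f @` setT)%classic); last first.
  exact/finite_image/finite_finset.
move=> z /interval_sortk[_ _ /weak_le_len zy].
have [u uz <-] := cox_length_word S z; rewrite -uz in zy.
by exists (Bseq zy).
Qed.

Theorem interval_EL_shellable : EL_shellable P.
Proof.
have Px : P x by split=> //; apply: lexx.
have Py : P y by split=> //; apply: lexx.
split.
  split; first exact: finite_interval.
    by exists x => // z [].
  by exists y => // z [].
exists _, nat, (label letter 0) => u v Pu Pv uv.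
have [/interval_sortk[su _ _] /interval_sortk[sv _ _]] := (Pu, Pv).
have [p [pc pr pu pl]] := EL_intervalP letter_inj letter_surj sv su uv.
exists p; split=> //; first exact/interval_chain.
  by move=> q /(interval_chain _ Pu Pv); apply: pu.
by move=> q /(interval_chain _ Pu Pv); apply: pl.
Qed.

End Interval.
End Geometric.

(** * The real cosines of pi / m *)

Section Cosines.
Notation R := Rdefinitions.R.
Notation sin := Rtrigo_def.sin.
Notation cos := Rtrigo_def.cos.
Notation pi := Rtrigo1.PI.

Lemma sin_add (a b : R) : sin (a + b) = sin a * cos b + cos a * sin b.
Proof. exact: Rtrigo1.sin_plus. Qed.

Lemma sin_ge0 (a : R) : 0 <= a -> a <= pi -> 0 <= sin a.
Proof. by move=> /RleP a0 /RleP api; apply/RleP/Rtrigo1.sin_ge_0. Qed.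

Lemma sin_gt0 (a : R) : 0 < a -> a < pi -> 0 < sin a.
Proof. by move=> /RltP a0 /RltP api; apply/RltP/Rtrigo1.sin_gt_0. Qed.

Lemma pi_gt0 : 0 < pi :> R.
Proof. by apply/RltP/Rtrigo1.PI_RGT_0. Qed.

Lemma sin_2pi : sin (pi + pi) = 0.
Proof. by rewrite sin_add Rtrigo1.sin_PI mul0r mulr0 addr0. Qed.

Lemma cos_2pi : cos (pi + pi) = 1.
Proof.
have -> : cos (pi + pi) = cos pi * cos pi - sin pi * sin pi.
  exact: Cos_plus.cos_plus.
by rewrite Rtrigo1.cos_PI Rtrigo1.sin_PI mul0r subr0 mulrNN mul1r.
Qed.

Lemma cheb_sin (t : R) k : cheb (cos t) k * sin t = sin (k%:R * t).
Proof.
suff: cheb (cos t) k * sin t = sin (k%:R * t) /\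
      cheb (cos t) k.+1 * sin t = sin (k.+1%:R * t) by case.
elim: k => [|k [IH1 IH2]].
  by rewrite cheb0 cheb1 !mul0r !mul1r; split=> //; rewrite Rtrigo_def.sin_0.
split=> //; rewrite chebSS mulrBl -[_ * _ * sin t]mulrA IH2 IH1.
have -> : k.+2%:R * t = k.+1%:R * t + t :> R.
  by rewrite -[k.+2]addn1 natrD mulrDl mul1r.
have -> : k%:R * t = k.+1%:R * t + - t :> R.
  by rewrite -[k.+1]addn1 natrD mulrDl mul1r addrK.
rewrite !sin_add Rtrigo1.cos_neg Rtrigo1.sin_neg !RoppE; ring.
Qed.

Lemma cos_pi_over m : (1 < m)%N -> is_cos_pi_over m (cos (pi / m%:R) : R).
Proof.
move=> m1; set t : R := pi / m%:R.
have m0 : 0 < m%:R :> R by rewrite ltr0n ltnW.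
have mt : m%:R * t = pi by rewrite mulrC divfK // gt_eqF.
have t0 : 0 < t by rewrite divr_gt0 // pi_gt0.
have le_pi k : (k <= m)%N -> k%:R * t <= pi.
  by move=> km; rewrite -mt ler_pM2r // ler_nat.
have s0 : 0 < sin t.
  by apply: sin_gt0 => //; rewrite -mt ltr_pMl // ltr1n.
have sum1 : sin t * sin t + cos t * cos t = 1 by exact: Rtrigo1.sin2_cos2.
have ge0 k : (k <= m)%N -> 0 <= cheb (cos t) k.
  move=> km; rewrite -(pmulr_lge0 _ s0) cheb_sin; apply: sin_ge0; last exact: le_pi.
  by rewrite mulr_ge0 ?ler0n // ltW.
(* The Chebyshev value at index 2 is twice the cosine, and 2 is at most [m]. *)
have c0 : 0 <= cos t.
  by have := ge0 _ m1; rewrite chebSS cheb0 cheb1 subr0 mulr1 pmulr_rge0.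
have two : (m + m)%:R * t = pi + pi by rewrite natrD mulrDl mt.
have ns : sin t != 0 by rewrite gt_eqF.
split=> //.
- rewrite ltNge; apply/negP => c1; have : 0 < sin t * sin t by apply: mulr_gt0.
  have : 0 <= (cos t - 1) * (cos t + 1) by apply: mulr_ge0; lra.
  lra.
- by apply: (mulIf ns); rewrite cheb_sin two sin_2pi mul0r.
- apply: (mulIf ns); rewrite cheb_sin -addn1 natrD mulrDl !mul1r two.
  by rewrite sin_add sin_2pi cos_2pi mul0r add0r mul1r.
Qed.

End Cosines.

Lemma set1_EL_shellable (d : Order.disp_t) (T : porderType d) (P : set T) a :
  P a -> (forall x, P x -> x = a) -> EL_shellable P.
Proof.
move=> Pa aP; split.
  split; [|by exists a => // x /aP->|by exists a => // x /aP->].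
  by apply: (@sub_finite_set _ _ [set a]%classic) => // x /aP.
exists _, nat, (fun _ _ => 0%N) => x y /aP-> /aP-> _; exists [::]; split=> //.
have nil q : maximal_chain P a a q -> q = [::].
  case: q => // b q [/= /andP[/asboolP[_ /aP-> + _] _] _].
  by rewrite ltxx.
by move=> q /nil.
Qed.

Theorem theorem1p1 (W : groupType) (n : nat) (S : coxeter_system W n)
    (gamma : W) (c : 'S_n) (gammaE : gamma = (\prod_(j < n) S (c j))%g)
    (x y : weak_order S) (Cx : cambrian c x) (Cy : cambrian c y)
    (xy : (x <= y)%O) :
  EL_shellable (cambrian_interval c x y).
Proof.
(* Without generators [letter] is undefined, but [W] is trivial and the interval is a point. *)
have [n0|n_gt0] := posnP n; last first.
  exact: (interval_EL_shellable cos_pi_over n_gt0 Cx Cy xy).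
have x1 (w : W) : w = 1%g.
  have [[|i u] <-] := gen_word S w; first by rewrite /eval_word big_nil.
  by have := ltn_ord i; rewrite [X in (_ < X)%N]n0.
apply: (@set1_EL_shellable _ _ _ x) => [|z _]; first by split=> //; apply: lexx.
by rewrite [z]x1 [x]x1.
Qed.
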